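(* Let $I$ be a non-empty (possibly uncountable) set and let $(A_i)_{i\in I}$ be a family of Banach algebras. Let $A:=c_0\text{-}\bigoplus_{i\in I}A_i$ be the Banach algebra of all families $(a_i)_{i\in I}$ with $a_i\in A_i$ and $(\|a_i\|)_{i\in I}\in c_0(I)$, with norm $\sup_{i\in I}\|a_i\|$ and coordinatewise multiplication. Then $$\mathrm{AM}(A)=\sup_{i\in I}\mathrm{AM}(A_i).$$ In particular, $A$ is amenable if and only if the family $(\mathrm{AM}(A_i))_{i\in I}$ is bounded.
   Context: All Banach algebras are complex. For a Banach algebra $A$, $A\widehat{\otimes}A$ is the projective tensor product, $\pi\colon A\widehat{\otimes}A\to A$ is the product map $\pi(a\otimes b)=ab$, and $A\widehat{\otimes}A$ is an $A$-bimodule via $a\cdot(x\otimes y)=(ax)\otimes y$, $(x\otimes y)\cdot a=x\otimes(ya)$; the actions extend canonically to $(A\widehat{\otimes}A)^{**}$. A virtual diagonal for $A$ is $M\in(A\widehat{\otimes}A)^{**}$ with $a\cdot M=M\cdot a$ and $a\cdot\pi^{**}(M)=a=\pi^{**}(M)\cdot a$ for all $a\in A$. $A$ is amenable if it has a virtual diagonal; then $\mathrm{AM}(A):=\inf\{\|M\|: M \text{ a virtual diagonal for } A\}$, and $\mathrm{AM}(A):=+\infty$ if $A$ is not amenable. ''Bounded'' for the family $(\mathrm{AM}(A_i))_i$ means $\sup_i\mathrm{AM}(A_i)<\infty$. *)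

(* Defs.v *)
From HB Require Import structures.
From mathcomp Require Import all_boot all_order all_algebra.
From mathcomp Require Import complex.
From mathcomp Require Import all_classical all_reals.
From mathcomp Require Import ereal topology normedtype sequences.
From mathcomp Require Import lra.

Set Implicit Arguments.
Unset Strict Implicit.
Unset Printing Implicit Defensive.

Import Order.TTheory GRing.Theory Num.Theory.
Import numFieldNormedType.Exports.

Local Open Scope classical_set_scope.
Local Open Scope complex_scope.
Local Open Scope ring_scope.
Local Open Scope quotient_scope.

(* The library norm of a normed module over R[i] is R[i]-valued; rnorm is the
   same norm as a real number (lemma normE). *)
Definition rnorm (R : realType) (X : normedModType R[i]) (x : X) : R :=
  complex.Re `|x|.

Section LinearPredicate.
Variables (K : nzRingType) (U V : lmodType K) (f : U -> V).
Hypothesis lf : linear f.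

Lemma lin0 : f 0 = 0.
Proof. by have := lf (-1) 0 0; rewrite scaler0 addr0 scaleN1r addNr. Qed.

Lemma linD x y : f (x + y) = f x + f y.
Proof. by have := lf 1 x y; rewrite !scale1r. Qed.

Lemma linZ a x : f (a *: x) = a *: f x.
Proof. by have := lf a x 0; rewrite lin0 !addr0. Qed.

Lemma linN x : f (- x) = - f x.
Proof. by rewrite -scaleN1r linZ scaleN1r. Qed.

Lemma linB x y : f (x - y) = f x - f y.
Proof. by rewrite linD linN. Qed.

End LinearPredicate.

Section RealNorm.
Variables (R : realType) (X : normedModType R[i]).
Implicit Types x y : X.

Lemma normE x : `|x| = (rnorm x)%:C.
Proof. by rewrite /rnorm RRe_real// ger0_real. Qed.

Lemma rnorm_ge0 x : 0 <= rnorm x.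
Proof. by rewrite -lecR -normE; exact: normr_ge0. Qed.

Lemma rnorm0 : rnorm (0 : X) = 0.
Proof. by rewrite /rnorm normr0. Qed.

Lemma rnorm0_eq0 x : rnorm x = 0 -> x = 0.
Proof. by move=> x0; apply/eqP; rewrite -normr_eq0 normE x0. Qed.

Lemma rnormN x : rnorm (- x) = rnorm x.
Proof. by rewrite /rnorm normrN. Qed.

Lemma rnormB x y : rnorm (x - y) = rnorm (y - x).
Proof. by rewrite /rnorm distrC. Qed.

Lemma ler_rnormD x y : rnorm (x + y) <= rnorm x + rnorm y.
Proof. by rewrite -lecR rmorphD/= -!normE ler_normD. Qed.

Lemma ler_rnormB x y : rnorm (x - y) <= rnorm x + rnorm y.
Proof. by rewrite -[rnorm y]rnormN ler_rnormD. Qed.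

Lemma rnormZ (a : R[i]) x : rnorm (a *: x) = rnorm (a : R[i]^o) * rnorm x.
Proof.
apply: complexI; rewrite rmorphM/= -!normE normrZ; congr (_ * _).
Qed.

Lemma ler_rnorm_sum I (s : seq I) (F : I -> X) :
  rnorm (\sum_(i <- s) F i) <= \sum_(i <- s) rnorm (F i).
Proof.
elim: s => [|i s IH]; first by rewrite !big_nil rnorm0.
by rewrite !big_cons (le_trans (ler_rnormD _ _))// lerD2l.
Qed.

End RealNorm.

Section BoundedOperator.
Variable R : realType.
Local Notation C := R[i].

Definition bounded_op (X Y : normedModType C) (f : X -> Y) :=
  exists k : R, forall x, rnorm (f x) <= k * rnorm x.

Record bop (X Y : normedModType C) := Bop {
  bop_fun :> X -> Y;
  bop_lin : linear bop_fun;
  bop_bdd : bounded_op bop_fun }.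

End BoundedOperator.

HB.instance Definition _ (R : realType) (X Y : normedModType R[i]) :=
  gen_eqMixin (bop X Y).
HB.instance Definition _ (R : realType) (X Y : normedModType R[i]) :=
  gen_choiceMixin (bop X Y).

Section OperatorSpace.
Variables (R : realType) (X Y : normedModType R[i]).
Implicit Types f g : bop X Y.

Lemma bopP f g : (forall x, f x = g x) -> f = g.
Proof.
case: f g => [f lf bf] [g lg bg]/= /funext fg.
by subst g; congr Bop; exact: Prop_irrelevance.
Qed.

Lemma bop_bdd_pos f : exists2 k : R, 0 <= k & forall x, rnorm (f x) <= k * rnorm x.
Proof.
have [k kP] := bop_bdd f; exists `|k|%R => // x.
by rewrite (le_trans (kP x))// ler_wpM2r ?rnorm_ge0// ler_norm.
Qed.

Lemma bop0_subproof : linear (fun _ : X => 0 : Y).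
Proof. by move=> a x y; rewrite scaler0 addr0. Qed.

Lemma bop0_bdd : bounded_op (fun _ : X => 0 : Y).
Proof. by exists 0 => x; rewrite rnorm0 mul0r. Qed.

Lemma bopD_subproof f g : linear (fun x => f x + g x).
Proof.
move=> a x y; rewrite (bop_lin f) (bop_lin g) scalerDr !addrA; congr (_ + _).
by rewrite addrAC.
Qed.

Lemma bopD_bdd f g : bounded_op (fun x => f x + g x).
Proof.
have [k kP] := bop_bdd f; have [l lP] := bop_bdd g; exists (k + l) => x.
by rewrite (le_trans (ler_rnormD _ _))// mulrDl lerD.
Qed.

Lemma bopZ_subproof (c : R[i]) f : linear (fun x => c *: f x).
Proof.
by move=> a x y; rewrite (bop_lin f) scalerDr !scalerA mulrC.
Qed.

Lemma bopZ_bdd (c : R[i]) f : bounded_op (fun x => c *: f x).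
Proof.
have [k kP] := bop_bdd f; exists (rnorm (c : R[i]^o) * k) => x.
by rewrite rnormZ -mulrA ler_wpM2l ?rnorm_ge0.
Qed.

Definition bop_zero := Bop bop0_subproof bop0_bdd.
Definition bop_add f g := Bop (@bopD_subproof f g) (@bopD_bdd f g).
Definition bop_scale (c : R[i]) f := Bop (@bopZ_subproof c f) (@bopZ_bdd c f).

Lemma bop_addA : associative bop_add.
Proof. by move=> f g h; apply: bopP => x /=; rewrite addrA. Qed.
Lemma bop_addC : commutative bop_add.
Proof. by move=> f g; apply: bopP => x /=; rewrite addrC. Qed.
Lemma bop_add0 : left_id bop_zero bop_add.
Proof. by move=> f; apply: bopP => x /=; rewrite add0r. Qed.
Lemma bop_addN : left_inverse bop_zero (bop_scale (-1)) bop_add.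
Proof. by move=> f; apply: bopP => x /=; rewrite scaleN1r addNr. Qed.

HB.instance Definition _ :=
  GRing.isZmodule.Build (bop X Y) bop_addA bop_addC bop_add0 bop_addN.

Lemma bop_scaleA a b f : bop_scale a (bop_scale b f) = bop_scale (a * b) f.
Proof. by apply: bopP => x /=; rewrite scalerA. Qed.
Lemma bop_scale1 : left_id 1 bop_scale.
Proof. by move=> f; apply: bopP => x /=; rewrite scale1r. Qed.
Lemma bop_scaleDr : right_distributive bop_scale +%R.
Proof. by move=> a f g; apply: bopP => x /=; rewrite scalerDr. Qed.
Lemma bop_scaleDl f a b : bop_scale (a + b) f = bop_scale a f + bop_scale b f.
Proof. by apply: bopP => x /=; rewrite scalerDl. Qed.

HB.instance Definition _ := GRing.Zmodule_isLmodule.Build R[i] (bop X Y)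
  bop_scaleA bop_scale1 bop_scaleDr bop_scaleDl.

Lemma bopDE f g x : (f + g) x = f x + g x. Proof. by []. Qed.
Lemma bopZE a f x : (a *: f) x = a *: f x. Proof. by []. Qed.
Lemma bopNE f x : (- f) x = - f x.
Proof. by rewrite -[LHS]/(-1 *: f x) scaleN1r. Qed.

Definition opnorm f : R := sup [set rnorm (f x) | x in [set x | rnorm x <= 1]].

Lemma opnorm_has_sup f :
  has_sup [set rnorm (f x) | x in [set x | rnorm x <= 1]].
Proof.
split; first by exists (rnorm (f 0)), 0 => //=; rewrite rnorm0.
have [k k0 kP] := bop_bdd_pos f; exists k => _ [x /= x1 <-].
by rewrite (le_trans (kP x))// ler_piMr.
Qed.

Lemma rnorm_real (r : R) : 0 <= r -> rnorm (r%:C : R[i]^o) = r.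
Proof. by move=> r0; rewrite /rnorm ger0_norm// lecR. Qed.

Lemma opnorm_ub f x : rnorm (f x) <= opnorm f * rnorm x.
Proof.
have [x0|x0] := eqVneq (rnorm x) 0.
  by rewrite (rnorm0_eq0 x0) (lin0 (bop_lin f)) !rnorm0 mulr0.
have xp : 0 < rnorm x by rewrite lt_neqAle eq_sym x0 rnorm_ge0.
rewrite -ler_pdivrMr//.
have -> : rnorm (f x) / rnorm x = rnorm (f (((rnorm x)^-1)%:C *: x)).
  rewrite (linZ (bop_lin f)) rnormZ rnorm_real ?invr_ge0 ?rnorm_ge0//.
  by rewrite mulrC.
apply: sup_ubound; first exact: (opnorm_has_sup f).2.
eexists; last by [].
by rewrite /= rnormZ rnorm_real ?invr_ge0 ?rnorm_ge0// mulVf.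
Qed.

Lemma opnorm_le f (k : R) : 0 <= k -> (forall x, rnorm (f x) <= k * rnorm x) ->
  opnorm f <= k.
Proof.
move=> k0 kP; apply: ge_sup; first exact: (opnorm_has_sup f).1.
by move=> _ [x /= x1 <-]; rewrite (le_trans (kP x))// ler_piMr.
Qed.

Lemma opnorm_ge0 f : 0 <= opnorm f.
Proof.
apply: le_trans (rnorm_ge0 (f 0)) _; apply: sup_ubound.
  exact: (opnorm_has_sup f).2.
by exists 0 => //=; rewrite rnorm0.
Qed.

Lemma opnormD f g : (opnorm (f + g))%:C <= (opnorm f)%:C + (opnorm g)%:C.
Proof.
rewrite -rmorphD lecR; apply: opnorm_le; first by rewrite addr_ge0 ?opnorm_ge0.
move=> x; rewrite bopDE mulrDl (le_trans (ler_rnormD _ _))//.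
by rewrite lerD ?opnorm_ub.
Qed.

Lemma opnormZ_le (a : R[i]) f : opnorm (a *: f) <= rnorm (a : R[i]^o) * opnorm f.
Proof.
apply: opnorm_le; first by rewrite mulr_ge0 ?opnorm_ge0 ?rnorm_ge0.
by move=> x; rewrite bopZE rnormZ -mulrA ler_wpM2l ?rnorm_ge0 ?opnorm_ub.
Qed.

Lemma opnormZ (a : R[i]) f : (opnorm (a *: f))%:C = `|a| * (opnorm f)%:C.
Proof.
rewrite [`|a|](normE (a : R[i]^o)) -rmorphM/=; congr (_%:C); apply/eqP.
rewrite eq_le opnormZ_le/=.
have [->|a0] := eqVneq a 0; first by rewrite rnorm0 mul0r opnorm_ge0.
have r0 : 0 < rnorm (a : R[i]^o).
  rewrite lt_neqAle rnorm_ge0 andbT eq_sym; apply: contra a0 => /eqP.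
  by move=> /rnorm0_eq0 ->.
rewrite mulrC -ler_pdivlMr// mulrC.
have -> : (rnorm (a : R[i]^o))^-1 = rnorm (a^-1 : R[i]^o).
  apply: (mulfI (lt0r_neq0 r0)); rewrite mulfV ?lt0r_neq0//.
  rewrite -rnormZ /GRing.scale/= mulfV//.
  by rewrite -(rnorm_real (@ler01 R)) //.
by rewrite (le_trans _ (opnormZ_le _ _))// scalerA mulVf// scale1r.
Qed.

Lemma opnorm0_eq0 f : (opnorm f)%:C = 0 :> R[i] -> f = 0.
Proof.
move=> [f0]; apply: bopP => x; apply: rnorm0_eq0; apply/eqP.
by rewrite eq_le rnorm_ge0 andbT (le_trans (opnorm_ub _ _))// f0 mul0r.
Qed.

HB.instance Definition _ := Lmodule_isNormed.Build R[i] (bop X Y)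
  opnormD opnormZ opnorm0_eq0.

Lemma bop_rnormE f : rnorm f = opnorm f. Proof. by []. Qed.

End OperatorSpace.

Definition dual (R : realType) (X : normedModType R[i]) : normedModType R[i] :=
  bop X R[i]^o.

Section Adjoint.
Variables (R : realType) (X Y : normedModType R[i]).
Implicit Types T : bop X Y.

Lemma adj_fun_lin T (g : dual Y) : linear (fun x : X => g (T x)).
Proof. by move=> a x y; rewrite (bop_lin T) (bop_lin g). Qed.

Lemma adj_fun_bdd T (g : dual Y) :
  bounded_op (fun x : X => g (T x)).
Proof.
exists (opnorm g * opnorm T) => x.
rewrite (le_trans (opnorm_ub _ _))// -mulrA.
by rewrite ler_wpM2l ?opnorm_ge0 ?opnorm_ub.
Qed.

Definition adj_fun T (g : dual Y) : dual X :=
  Bop (@adj_fun_lin T g) (@adj_fun_bdd T g).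

Lemma adj_lin T : linear (adj_fun T).
Proof. by move=> a g h; apply: bopP. Qed.

Lemma adj_bdd T : bounded_op (adj_fun T).
Proof.
exists (opnorm T) => g; apply: opnorm_le.
  by rewrite mulr_ge0 ?opnorm_ge0 ?rnorm_ge0.
move=> x /=; apply: le_trans (opnorm_ub _ _) _.
rewrite [opnorm T * _]mulrC -mulrA.
by apply: ler_wpM2l; [exact: opnorm_ge0|exact: opnorm_ub].
Qed.

Definition adj T : bop (dual Y) (dual X) := Bop (@adj_lin T) (@adj_bdd T).

Lemma adjE T g x : adj T g x = g (T x).
Proof. by []. Qed.

End Adjoint.

Section CanonicalEmbedding.
Variables (R : realType) (X : normedModType R[i]).

Lemma eval_dual_lin (x : X) : linear (fun f : dual X => f x : R[i]^o).
Proof. by []. Qed.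

Lemma eval_dual_bdd (x : X) :
  bounded_op (fun f : dual X => f x : R[i]^o).
Proof. by exists (rnorm x) => f; rewrite mulrC; exact: opnorm_ub. Qed.

Definition eval_dual (x : X) : dual (dual X) :=
  Bop (@eval_dual_lin x) (@eval_dual_bdd x).

End CanonicalEmbedding.

Section AlgebraicTensorProduct.
Variables (K : comNzRingType) (U V : lmodType K).
Implicit Types s t : seq (U * V).

Definition tensor_eval (W : lmodType K) (f : U -> V -> W) s : W :=
  \sum_(p <- s) f p.1 p.2.

(* A sequence (u_k, v_k)_k stands for the formal sum of the u_k (x) v_k.
   Two formal sums are the same tensor iff no bilinear map into any vector
   space distinguishes them. *)
Definition tensor_rel s t : bool :=
  `[< forall (W : lmodType K) (f : U -> V -> W),
        bilinear_for *:%R *:%R f -> tensor_eval f s = tensor_eval f t >].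

Lemma tensor_relxx : reflexive tensor_rel.
Proof. by move=> s; apply/asboolP. Qed.

Lemma tensor_rel_sym : symmetric tensor_rel.
Proof.
by move=> s t; apply/asboolP/asboolP => st W f /st.
Qed.

Lemma tensor_rel_trans : transitive tensor_rel.
Proof.
move=> t s r /asboolP st /asboolP tr; apply/asboolP => W f bf.
by rewrite (st W f bf) tr.
Qed.

Canonical tensor_equiv :=
  EquivRel tensor_rel tensor_relxx tensor_rel_sym tensor_rel_trans.

Definition tensor := {eq_quot tensor_rel}.
HB.instance Definition _ := Choice.on tensor.
HB.instance Definition _ := Quotient.on tensor.
HB.instance Definition _ := EqQuotient.on tensor.

Definition tensor_of s : tensor := \pi s.

Lemma tensor_eqP s t : reflect
  (forall (W : lmodType K) (f : U -> V -> W),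
     bilinear_for *:%R *:%R f -> tensor_eval f s = tensor_eval f t)
  (tensor_of s == tensor_of t).
Proof. by rewrite eqmodE; exact: asboolP. Qed.

Lemma tensorP s t :
  (forall (W : lmodType K) (f : U -> V -> W),
     bilinear_for *:%R *:%R f -> tensor_eval f s = tensor_eval f t) ->
  tensor_of s = tensor_of t.
Proof. by move=> /tensor_eqP/eqP. Qed.

Lemma tensor_reprK (x : tensor) : tensor_of (repr x) = x.
Proof. exact: reprK. Qed.

Definition tensor_lift (W : lmodType K) (f : U -> V -> W) (x : tensor) : W :=
  tensor_eval f (repr x).

Lemma tensor_liftE (W : lmodType K) (f : U -> V -> W) s :
  bilinear_for *:%R *:%R f -> tensor_lift f (tensor_of s) = tensor_eval f s.
Proof.
by move=> bf; apply/tensor_eqP => //; rewrite tensor_reprK.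
Qed.

Lemma tensor_ext (x y : tensor) :
  (forall (W : lmodType K) (f : U -> V -> W),
     bilinear_for *:%R *:%R f -> tensor_lift f x = tensor_lift f y) -> x = y.
Proof. by move=> xy; rewrite -[x]tensor_reprK -[y]tensor_reprK; apply: tensorP. Qed.

Definition scale_seq (a : K) s : seq (U * V) := [seq (a *: p.1, p.2) | p <- s].

Lemma tensor_eval_cat (W : lmodType K) (f : U -> V -> W) s t :
  tensor_eval f (s ++ t) = tensor_eval f s + tensor_eval f t.
Proof. exact: big_cat. Qed.

Lemma tensor_eval_scale (W : lmodType K) (f : U -> V -> W) a s :
  bilinear_for *:%R *:%R f ->
  tensor_eval f (scale_seq a s) = a *: tensor_eval f s.
Proof.
move=> [fl _]; rewrite /tensor_eval big_map scaler_sumr; apply: eq_bigr => p _ /=.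
exact: (linZ (fl p.2)).
Qed.

Definition tensor0 : tensor := tensor_of [::].
Definition tensor_add (x y : tensor) : tensor := tensor_of (repr x ++ repr y).
Definition tensor_scale (a : K) (x : tensor) : tensor :=
  tensor_of (scale_seq a (repr x)).

Section Lift.
Variables (W : lmodType K) (f : U -> V -> W).
Hypothesis bf : bilinear_for *:%R *:%R f.

Lemma tensor_lift0 : tensor_lift f tensor0 = 0.
Proof. by rewrite tensor_liftE// /tensor_eval big_nil. Qed.

Lemma tensor_liftD x y :
  tensor_lift f (tensor_add x y) = tensor_lift f x + tensor_lift f y.
Proof. by rewrite tensor_liftE// tensor_eval_cat. Qed.

Lemma tensor_liftZ a x :
  tensor_lift f (tensor_scale a x) = a *: tensor_lift f x.
Proof. by rewrite tensor_liftE// tensor_eval_scale. Qed.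
End Lift.

Lemma tensor_addA : associative tensor_add.
Proof. by move=> x y z; apply: tensor_ext => W f bf; rewrite !tensor_liftD// addrA. Qed.
Lemma tensor_addC : commutative tensor_add.
Proof. by move=> x y; apply: tensor_ext => W f bf; rewrite !tensor_liftD// addrC. Qed.
Lemma tensor_add0 : left_id tensor0 tensor_add.
Proof.
by move=> x; apply: tensor_ext => W f bf; rewrite tensor_liftD// tensor_lift0// add0r.
Qed.
Lemma tensor_addN : left_inverse tensor0 (tensor_scale (-1)) tensor_add.
Proof.
move=> x; apply: tensor_ext => W f bf.
by rewrite tensor_liftD// tensor_liftZ// tensor_lift0// scaleN1r addNr.
Qed.

HB.instance Definition _ := GRing.isZmodule.Build tensor
  tensor_addA tensor_addC tensor_add0 tensor_addN.

Lemma tensor_scaleA a b x : tensor_scale a (tensor_scale b x) = tensor_scale (a * b) x.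
Proof. by apply: tensor_ext => W f bf; rewrite !tensor_liftZ// scalerA. Qed.
Lemma tensor_scale1 : left_id 1 tensor_scale.
Proof. by move=> x; apply: tensor_ext => W f bf; rewrite !tensor_liftZ// scale1r. Qed.
Lemma tensor_scaleDr : right_distributive tensor_scale +%R.
Proof.
move=> a x y; apply: tensor_ext => W f bf.
by rewrite tensor_liftZ// !tensor_liftD// !tensor_liftZ// scalerDr.
Qed.
Lemma tensor_scaleDl x a b : tensor_scale (a + b) x = tensor_scale a x + tensor_scale b x.
Proof.
apply: tensor_ext => W f bf.
by rewrite !tensor_liftD// !tensor_liftZ// scalerDl.
Qed.

HB.instance Definition _ := GRing.Zmodule_isLmodule.Build K tensor
  tensor_scaleA tensor_scale1 tensor_scaleDr tensor_scaleDl.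

Lemma tensor_lift_lin (W : lmodType K) (f : U -> V -> W) :
  bilinear_for *:%R *:%R f -> linear (tensor_lift f).
Proof. by move=> bf a x y; rewrite tensor_liftD// tensor_liftZ. Qed.

Lemma tensor_of_cat s t : tensor_of (s ++ t) = tensor_of s + tensor_of t.
Proof.
apply: tensor_ext => W f bf.
by rewrite (linD (tensor_lift_lin bf)) !tensor_liftE// tensor_eval_cat.
Qed.

Lemma tensor_of_scale a s : tensor_of (scale_seq a s) = a *: tensor_of s.
Proof.
apply: tensor_ext => W f bf.
by rewrite (linZ (tensor_lift_lin bf)) !tensor_liftE// tensor_eval_scale.
Qed.

Definition tens (u : U) (v : V) : tensor := tensor_of [:: (u, v)].

Lemma tens_bilinear : bilinear_for *:%R *:%R tens.
Proof.
split=> [v a x y|u a x y]; apply: tensor_ext => W f bf;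
  rewrite (tensor_lift_lin bf) !tensor_liftE// /tensor_eval !big_seq1/=.
- exact: bf.1.
- exact: bf.2.
Qed.

Lemma tensor_lift_tens (W : lmodType K) (f : U -> V -> W) u v :
  bilinear_for *:%R *:%R f -> tensor_lift f (tens u v) = f u v.
Proof. by move=> bf; rewrite tensor_liftE// /tensor_eval big_seq1. Qed.

Lemma tensor_of_sum s : tensor_of s = \sum_(p <- s) tens p.1 p.2.
Proof.
elim: s => [|[u v] s IH]; first by rewrite big_nil.
by rewrite big_cons -IH -tensor_of_cat.
Qed.

End AlgebraicTensorProduct.

Lemma complex_gt0 (R : realType) (e : R[i]) :
  0 < e -> 0 < complex.Re e /\ (complex.Re e)%:C = e.
Proof.
by case: e => a b; rewrite ltcE/= => /andP[/eqP -> a0]; split.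
Qed.

Section SequentialCompleteness.
Variables (R : realType) (X : normedModType R[i]).
Implicit Types (u : nat -> X) (l : X).

Lemma rcvgP u l : (u n @[n --> \oo] --> l) <->
  (forall e : R, 0 < e -> \forall n \near \oo, rnorm (l - u n) < e).
Proof.
split=> [/cvgrPdist_lt ul e e0|ul].
  have /ul : 0 < e%:C by rewrite ltcR.
  by apply: filterS => n; rewrite normE ltcR.
apply/cvgrPdist_lt => e /complex_gt0[e0 <-].
by apply: filterS (ul _ e0) => n; rewrite normE ltcR.
Qed.

Definition rcauchy u := forall e : R, 0 < e ->
  exists N, forall m n, (N <= m)%N -> (N <= n)%N -> rnorm (u m - u n) < e.

Lemma rcauchy_cauchy u : rcauchy u -> cauchy (u n @[n --> \oo]).
Proof.
move=> cu; apply: cauchy_exP => e /complex_gt0[e0 <-].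
have [N NP] := cu _ e0; exists (u N); exists N => // n /= Nn.
by rewrite -ball_normE/= normE ltcR NP.
Qed.

Lemma rcomplete : (forall u, rcauchy u -> exists l, u n @[n --> \oo] --> l) ->
  forall F : set_system X, ProperFilter F -> cauchy F -> cvg F.
Proof.
move=> seqc F PF /cauchyP cF.
have h (n : nat) : {x : X | F (ball x ((n.+1%:R^-1 : R)%:C))}.
  by apply/cid/cF; rewrite ltcR invr_gt0.
pose u n := sval (h n).
have uF n : F (ball (u n) ((n.+1%:R^-1 : R)%:C)) by exact: svalP (h n).
have udist m n : rnorm (u m - u n) < m.+1%:R^-1 + n.+1%:R^-1.
  have [z [zm zn]] : ball (u m) ((m.+1%:R^-1 : R)%:C) `&`
      ball (u n) ((n.+1%:R^-1 : R)%:C) !=set0.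
    exact: filter_ex (filterI (uF m) (uF n)).
  move: zm zn; rewrite -!ball_normE/= !normE !ltcR => zm zn.
  rewrite -[u m](subrK z) -addrA (le_lt_trans (ler_rnormD _ _))// ltrD//.
  by rewrite rnormB.
have small (e : R) : 0 < e -> exists N : nat, forall n, (N <= n)%N -> n.+1%:R^-1 < e.
  move=> e0; exists (Num.trunc e^-1) => n Nn.
  rewrite invf_plt ?posrE//.
  by rewrite (lt_le_trans (truncnS_gt _))// ler_nat ltnS.
have [|l /rcvgP ul] := seqc u.
  move=> e e0; have [//|N NP] := small (e / 2) _; first by rewrite divr_gt0.
  exists N => m n Nm Nn; rewrite (lt_trans (udist _ _))//.
  by rewrite [ltRHS]splitr ltrD ?NP.
apply/cvg_ex; exists l; apply/cvg_ballP => e /complex_gt0[e0 <-].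
have e20 : 0 < complex.Re e / 2 by rewrite divr_gt0.
have [N NP] := small _ e20.
have [M _ MP] := ul _ e20.
pose k := maxn N M.
apply: filterS (uF k) => z; rewrite -!ball_normE/= !normE !ltcR => zk.
rewrite -[l](subrK (u k)) -addrA (le_lt_trans (ler_rnormD _ _))//.
rewrite [ltRHS]splitr ltrD//; first by apply: MP; rewrite /= leq_maxr.
by rewrite (lt_trans zk)// NP// leq_maxl.
Qed.

End SequentialCompleteness.

Lemma rcauchy_cvg (R : realType) (X : completeNormedModType R[i]) (u : nat -> X) :
  rcauchy u -> u n @[n --> \oo] --> lim (u n @[n --> \oo]).
Proof. by move=> /rcauchy_cauchy/cauchy_cvg. Qed.

Lemma real_cauchy_cvg (R : realType) (u : nat -> R) :
  (forall e : R, 0 < e -> exists N, forall m n, (N <= m)%N -> (N <= n)%N ->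
     `|u m - u n| < e) -> u n @[n --> \oo] --> lim (u n @[n --> \oo]).
Proof.
move=> cu; apply: cauchy_cvg; apply: cauchy_exP => e e0.
have [N NP] := cu _ e0; exists (u N); exists N => // n /= Nn.
by rewrite -ball_normE/= NP.
Qed.

Structure seminormedModType (R : realType) := SeminormedModType {
  seminormed_sort :> lmodType R[i];
  seminorm : seminormed_sort -> R;
  ler_seminormD : forall x y, seminorm (x + y) <= seminorm x + seminorm y;
  seminormZ : forall (a : R[i]) x,
    seminorm (a *: x) = rnorm (a : R[i]^o) * seminorm x }.

Section Completion.
Variables (R : realType) (E : seminormedModType R).
Local Notation p := (@seminorm R E).

Lemma seminorm0 : p 0 = 0.
Proof. by rewrite -(scale0r (0 : E)) seminormZ rnorm0 mul0r. Qed.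

Lemma rnorm_N1 : rnorm (-1 : R[i]^o) = 1 :> R.
Proof. by rewrite rnormN -[RHS](rnorm_real (@ler01 R)). Qed.

Lemma seminormN x : p (- x) = p x.
Proof. by rewrite -scaleN1r seminormZ rnorm_N1 mul1r. Qed.

Lemma seminormB x y : p (x - y) = p (y - x).
Proof. by rewrite -opprB seminormN. Qed.

Lemma seminorm_ge0 x : 0 <= p x.
Proof.
have := ler_seminormD x (- x); rewrite subrr seminorm0 seminormN -mulr2n.
by rewrite pmulrn_lge0.
Qed.

Lemma seminorm_trans y x z : p (x - z) <= p (x - y) + p (y - z).
Proof.
by rewrite (le_trans _ (ler_seminormD _ _))// addrA subrK.
Qed.

Lemma seminorm_dist x y : `|p x - p y| <= p (x - y).
Proof.
rewrite ler_norml; apply/andP; split.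
  have := ler_seminormD (y - x) x; rewrite subrK seminormB; lra.
have := ler_seminormD (x - y) y; rewrite subrK; lra.
Qed.

(* The Hausdorff completion of a seminormed space: Cauchy sequences modulo
   null sequences, normed by the limit of the seminorms. *)
Record cauchy_sequence := CauchySequence {
  cauchy_seq :> nat -> E;
  cauchy_seqP : forall e : R, 0 < e -> exists N, forall m n,
    (N <= m)%N -> (N <= n)%N -> p (cauchy_seq m - cauchy_seq n) < e }.

HB.instance Definition _ := gen_eqMixin cauchy_sequence.
HB.instance Definition _ := gen_choiceMixin cauchy_sequence.

Implicit Types u v w : cauchy_sequence.

Definition completion_rel u v : bool :=
  `[< p (u n - v n) @[n --> \oo] --> (0 : R) >].

Lemma completion_relxx : reflexive completion_rel.
Proof.
move=> u; apply/asboolP; rewrite (_ : (fun n => _) = fun=> 0); first exact: cvg_cst.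
by apply/funext => n; rewrite subrr seminorm0.
Qed.

Lemma completion_rel_sym : symmetric completion_rel.
Proof.
move=> u v; rewrite /completion_rel.
suff -> : (fun n => p (u n - v n)) = (fun n => p (v n - u n)) by [].
by apply/funext => n; rewrite seminormB.
Qed.

Lemma completion_rel_trans : transitive completion_rel.
Proof.
move=> v u w /asboolP uv /asboolP vw; apply/asboolP.
apply: (@squeeze_cvgr _ _ _ _ (fun=> 0) (fun n => p (u n - v n) + p (v n - w n))).
- by apply: nearW => n; rewrite seminorm_ge0 seminorm_trans.
- exact: cvg_cst.
- by rewrite -[X in _ --> X]addr0; exact: cvgD.
Qed.

Canonical completion_equiv :=
  EquivRel completion_rel completion_relxx completion_rel_sym completion_rel_trans.

Definition completion := {eq_quot completion_rel}.
HB.instance Definition _ := Choice.on completion.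
HB.instance Definition _ := Quotient.on completion.
HB.instance Definition _ := EqQuotient.on completion.

Definition completion_of u : completion := \pi u.

Lemma completion_reprK (x : completion) : completion_of (repr x) = x.
Proof. exact: reprK. Qed.

Lemma completionP u v :
  p (u n - v n) @[n --> \oo] --> (0 : R) <-> completion_of u = completion_of v.
Proof.
split=> [uv|/eqP]; first by apply/eqP; rewrite eqmodE; apply/asboolP.
by rewrite eqmodE => /asboolP.
Qed.

Lemma completion_repr u : p (repr (completion_of u) n - u n) @[n --> \oo] --> (0 : R).
Proof. by apply/completionP; rewrite completion_reprK. Qed.

Lemma cauchy_cst_subproof (x : E) : forall e : R, 0 < e -> exists N : nat, forall m n : nat,
  (N <= m)%N -> (N <= n)%N -> p ((fun=> x) m - (fun=> x) n) < e.
Proof. by move=> e e0; exists 0%N => m n _ _; rewrite subrr seminorm0. Qed.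
Definition cauchy_cst (x : E) : cauchy_sequence :=
  CauchySequence (cauchy_cst_subproof x).

Lemma cauchy_add_subproof u v : forall e : R, 0 < e -> exists N, forall m n,
  (N <= m)%N -> (N <= n)%N -> p ((u m + v m) - (u n + v n)) < e.
Proof.
move=> e e0; have e20 : 0 < e / 2 by rewrite divr_gt0.
have [M MP] := cauchy_seqP u e20; have [N NP] := cauchy_seqP v e20.
exists (maxn M N) => m n; rewrite !geq_max => /andP[Mm Nm] /andP[Mn Nn].
rewrite opprD addrACA (le_lt_trans (ler_seminormD _ _))//.
by rewrite [ltRHS]splitr ltrD ?MP ?NP.
Qed.
Definition cauchy_add u v : cauchy_sequence :=
  @CauchySequence (fun n => u n + v n) (@cauchy_add_subproof u v).

Lemma cauchy_scale_subproof (a : R[i]) u : forall e : R, 0 < e -> exists N, forall m n,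
  (N <= m)%N -> (N <= n)%N -> p (a *: u m - a *: u n) < e.
Proof.
move=> e e0; have a0 : 0 < rnorm (a : R[i]^o) + 1.
  by rewrite ltr_wpDl ?rnorm_ge0.
have /(cauchy_seqP u)[N NP] : 0 < e / (rnorm (a : R[i]^o) + 1) by rewrite divr_gt0.
exists N => m n Nm Nn; rewrite -scalerBr seminormZ.
have := NP _ _ Nm Nn; rewrite ltr_pdivlMr// mulrC; apply: le_lt_trans.
by rewrite ler_wpM2r ?seminorm_ge0// lerDl.
Qed.
Definition cauchy_scale (a : R[i]) u : cauchy_sequence :=
  @CauchySequence (fun n => a *: u n) (@cauchy_scale_subproof a u).

Definition completion_embed (x : E) : completion := completion_of (cauchy_cst x).
Definition completion_add (x y : completion) :=
  completion_of (cauchy_add (repr x) (repr y)).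
Definition completion_scale (a : R[i]) (x : completion) :=
  completion_of (cauchy_scale a (repr x)).

Lemma completion_ofD u v : completion_add (completion_of u) (completion_of v) =
  completion_of (cauchy_add u v).
Proof.
apply/completionP => /=; set f := (X in X @ _ --> _).
apply: (@squeeze_cvgr _ _ _ _ (fun=> 0) (fun n =>
  p (repr (completion_of u) n - u n) + p (repr (completion_of v) n - v n))).
- by apply: nearW => n; rewrite seminorm_ge0 /f opprD addrACA ler_seminormD.
- exact: cvg_cst.
- by rewrite -[X in _ --> X]addr0; apply: cvgD; exact: completion_repr.
Qed.

Lemma completion_ofZ a u : completion_scale a (completion_of u) =
  completion_of (cauchy_scale a u).
Proof.
apply/completionP => /=.
rewrite (_ : (fun n => _) = fun n =>
    rnorm (a : R[i]^o) * p (repr (completion_of u) n - u n)).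
  rewrite -[X in _ --> X](mulr0 (rnorm (a : R[i]^o))).
  by apply: cvgMl_tmp; exact: completion_repr.
by apply/funext => n; rewrite -scalerBr seminormZ.
Qed.

Lemma completion_ind (P : completion -> Prop) :
  (forall u, P (completion_of u)) -> forall x, P x.
Proof. by move=> Pu x; rewrite -[x]completion_reprK. Qed.

Lemma completion_of_eq u v : (forall n, u n = v n) ->
  completion_of u = completion_of v.
Proof.
move=> uv; apply/completionP; rewrite (_ : (fun n => _) = fun=> 0); first exact: cvg_cst.
by apply/funext => n; rewrite uv subrr seminorm0.
Qed.

Lemma completion_addA : associative completion_add.
Proof.
elim/completion_ind => u; elim/completion_ind => v; elim/completion_ind => w.
by rewrite !completion_ofD; apply: completion_of_eq => n /=; rewrite addrA.
Qed.
Lemma completion_addC : commutative completion_add.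
Proof.
elim/completion_ind => u; elim/completion_ind => v.
by rewrite !completion_ofD; apply: completion_of_eq => n /=; rewrite addrC.
Qed.
Lemma completion_add0 : left_id (completion_embed 0) completion_add.
Proof.
elim/completion_ind => u.
by rewrite !completion_ofD; apply: completion_of_eq => n /=; rewrite add0r.
Qed.
Lemma completion_addN :
  left_inverse (completion_embed 0) (completion_scale (-1)) completion_add.
Proof.
elim/completion_ind => u; rewrite completion_ofZ completion_ofD.
by apply: completion_of_eq => n /=; rewrite scaleN1r addNr.
Qed.

HB.instance Definition _ := GRing.isZmodule.Build completion
  completion_addA completion_addC completion_add0 completion_addN.

Lemma completion_scaleA a b x :
  completion_scale a (completion_scale b x) = completion_scale (a * b) x.
Proof.
elim/completion_ind: x => u; rewrite !completion_ofZ.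
by apply: completion_of_eq => n /=; rewrite scalerA.
Qed.
Lemma completion_scale1 : left_id 1 completion_scale.
Proof.
elim/completion_ind => u; rewrite !completion_ofZ.
by apply: completion_of_eq => n /=; rewrite scale1r.
Qed.
Lemma completion_scaleDr : right_distributive completion_scale +%R.
Proof.
move=> a; elim/completion_ind => u; elim/completion_ind => v.
rewrite -[_ + _]/(completion_add _ _) -[RHS]/(completion_add _ _).
rewrite !(completion_ofZ, completion_ofD).
by apply: completion_of_eq => n /=; rewrite scalerDr.
Qed.
Lemma completion_scaleDl x a b :
  completion_scale (a + b) x = completion_scale a x + completion_scale b x.
Proof.
elim/completion_ind: x => u; rewrite -[RHS]/(completion_add _ _).
rewrite !(completion_ofZ, completion_ofD).
by apply: completion_of_eq => n /=; rewrite scalerDl.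
Qed.

HB.instance Definition _ := GRing.Zmodule_isLmodule.Build R[i] completion
  completion_scaleA completion_scale1 completion_scaleDr completion_scaleDl.

Lemma completion_of_add u v :
  completion_of (cauchy_add u v) = completion_of u + completion_of v.
Proof. by rewrite -completion_ofD. Qed.

Lemma completion_of_scale a u :
  completion_of (cauchy_scale a u) = a *: completion_of u.
Proof. by rewrite -completion_ofZ. Qed.

Definition completion_norm (x : completion) : R :=
  lim (p (repr x n) @[n --> \oo]).

Lemma cauchy_seminorm_cvg u : p (u n) @[n --> \oo] --> lim (p (u n) @[n --> \oo]).
Proof.
apply: real_cauchy_cvg => e e0; have [N NP] := cauchy_seqP u e0.
by exists N => m n Nm Nn; rewrite (le_lt_trans (seminorm_dist _ _))// NP.
Qed.

Lemma completion_norm_cvg u : p (u n) @[n --> \oo] --> completion_norm (completion_of u).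
Proof.
have uv : p (u n) - p (repr (completion_of u) n) @[n --> \oo] --> (0 : R).
  apply/norm_cvg0P.
  apply: (@squeeze_cvgr _ _ _ _ (fun=> 0)
     (fun n => p (repr (completion_of u) n - u n))).
  - by apply: nearW => n; rewrite normr_ge0 seminormB seminorm_dist.
  - exact: cvg_cst.
  - exact: completion_repr.
have -> : (fun n => p (u n)) = (fun n => (p (u n) - p (repr (completion_of u) n)) +
    p (repr (completion_of u) n)) by apply/funext => n; rewrite subrK.
rewrite -[completion_norm _]add0r; apply: cvgD => //.
exact: cauchy_seminorm_cvg.
Qed.

Lemma completion_norm_ofE u (l : R) : p (u n) @[n --> \oo] --> l ->
  completion_norm (completion_of u) = l.
Proof.
move=> /(cvg_lim (@Rhausdorff R)) <-.
by apply/esym/(cvg_lim (@Rhausdorff R)); exact: completion_norm_cvg.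
Qed.

Lemma completion_normD x y :
  (completion_norm (x + y))%:C <= (completion_norm x)%:C + (completion_norm y)%:C.
Proof.
elim/completion_ind: x => u; elim/completion_ind: y => v.
rewrite -completion_of_add -rmorphD lecR.
apply: (@ler_cvg_to nat \oo _ _ (fun n => p (u n + v n)) (fun n => p (u n) + p (v n))).
- exact: (@completion_norm_cvg (cauchy_add u v)).
- by apply: cvgD; exact: completion_norm_cvg.
- by apply: nearW => n; exact: ler_seminormD.
Qed.

Lemma completion_normZ (a : R[i]) x :
  (completion_norm (a *: x))%:C = `|a| * (completion_norm x)%:C.
Proof.
elim/completion_ind: x => u; rewrite [`|a|](normE (a : R[i]^o)) -rmorphM/=.
congr (_%:C); rewrite -completion_of_scale; apply: completion_norm_ofE.
rewrite (_ : (fun n => _) = fun n => rnorm (a : R[i]^o) * p (u n)).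
  by apply: cvgMl_tmp; exact: completion_norm_cvg.
by apply/funext => n /=; rewrite seminormZ.
Qed.

Lemma completion_norm0_eq0 x : (completion_norm x)%:C = 0 :> R[i] -> x = 0.
Proof.
elim/completion_ind: x => u [u0]; apply/completionP.
rewrite (_ : (fun n => _) = fun n => p (u n)).
  by rewrite -[X in _ --> X]u0; exact: completion_norm_cvg.
by apply/funext => n /=; rewrite subr0.
Qed.

HB.instance Definition _ := Lmodule_isNormed.Build R[i] completion
  completion_normD completion_normZ completion_norm0_eq0.

Lemma completion_rnormE x : rnorm x = completion_norm x. Proof. by []. Qed.

Lemma completion_embed_lin : linear completion_embed.
Proof.
move=> a x y; rewrite -completion_of_scale -completion_of_add.
exact: completion_of_eq.
Qed.

Lemma rnorm_completion_embed (x : E) : rnorm (completion_embed x) = p x.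
Proof. rewrite completion_rnormE; apply: completion_norm_ofE.
by apply: cvg_cst; exact: eventually_filter. Qed.

Lemma completion_embed_cvg u : completion_embed (u n) @[n --> \oo] --> completion_of u.
Proof.
apply/rcvgP => e e0; have e20 : 0 < e / 2 by rewrite divr_gt0.
have [N NP] := cauchy_seqP u e20; exists N => // n /= Nn.
have -> : completion_of u - completion_embed (u n) =
    completion_of (cauchy_add u (cauchy_scale (-1) (cauchy_cst (u n)))).
  by rewrite completion_of_add completion_of_scale scaleN1r.
rewrite completion_rnormE; apply: (@le_lt_trans _ _ (e / 2)); last first.
  by rewrite ltr_pdivrMr// ltr_pMr// ltr1n.
apply: (@ler_cvg_to nat \oo _ _ (fun m => p (u m - u n)) (fun=> e / 2)).
- rewrite (_ : (fun m => _) = cauchy_seq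
    (cauchy_add u (cauchy_scale (-1) (cauchy_cst (u n)))) \; p).
    exact: completion_norm_cvg.
  by apply/funext => m /=; rewrite scaleN1r.
- exact: cvg_cst.
- by exists N => // m /= Nm; rewrite ltW// NP.
Qed.

Lemma completion_dense (x : completion) (e : R) : 0 < e ->
  exists y : E, rnorm (x - completion_embed y) < e.
Proof.
elim/completion_ind: x => u e0; have /rcvgP/(_ _ e0)[N _ NP] := @completion_embed_cvg u.
by exists (u N); apply: NP => /=.
Qed.

Lemma completion_complete (F : set_system completion) :
  ProperFilter F -> cauchy F -> cvg F.
Proof.
apply: rcomplete => U cU.
have inv_gt0 n : 0 < n.+1%:R^-1 :> R by rewrite invr_gt0.
pose x n : E := sval (cid (completion_dense (U n) (inv_gt0 n))).
have xU n : rnorm (U n - completion_embed (x n)) < n.+1%:R^-1.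
  exact: svalP (cid (completion_dense (U n) (inv_gt0 n))).
have small (e : R) : 0 < e -> exists N : nat, forall n, (N <= n)%N -> n.+1%:R^-1 < e.
  move=> e0; exists (Num.trunc e^-1) => n Nn.
  rewrite invf_plt ?posrE//.
  by rewrite (lt_le_trans (truncnS_gt _))// ler_nat ltnS.
have cx : forall e : R, 0 < e -> exists N, forall m n,
    (N <= m)%N -> (N <= n)%N -> p (x m - x n) < e.
  move=> e e0; have e30 : 0 < e / 3 by rewrite divr_gt0.
  have [M MP] := small _ e30; have [N NP] := cU _ e30.
  exists (maxn M N) => m n; rewrite !geq_max => /andP[Mm Nm] /andP[Mn Nn].
  rewrite -rnorm_completion_embed (linB completion_embed_lin).
  have -> : completion_embed (x m) - completion_embed (x n) =
      - (U m - completion_embed (x m)) + (U m - U n) + (U n - completion_embed (x n)).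
    by rewrite opprB !addrA !subrK.
  have := ler_rnormD (- (U m - completion_embed (x m)) + (U m - U n))
    (U n - completion_embed (x n)).
  have := ler_rnormD (- (U m - completion_embed (x m))) (U m - U n).
  rewrite rnormN => h1 h2.
  have := NP _ _ Nm Nn.
  have := lt_trans (xU m) (MP _ Mm); have := lt_trans (xU n) (MP _ Mn).
  lra.
exists (completion_of (CauchySequence cx)); apply/rcvgP => e e0.
have e20 : 0 < e / 2 by rewrite divr_gt0.
have [M MP] := small _ e20.
have /rcvgP/(_ _ e20)[N _ NP] := @completion_embed_cvg (CauchySequence cx).
exists (maxn M N) => // n /=; rewrite geq_max => /andP[Mn Nn].
have := NP n Nn => /= h.
have := ler_rnormD (completion_of (CauchySequence cx) - completion_embed (x n))
   (completion_embed (x n) - U n).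
rewrite addrA subrK (rnormB (completion_embed (x n))) => h1.
have := lt_trans (xU n) (MP _ Mn); lra.
Qed.

HB.instance Definition _ := Uniform_isComplete.Build completion completion_complete.

End Completion.

Section CompletionExtension.
Variables (R : realType) (E : seminormedModType R) (Y : completeNormedModType R[i]).
Variable T : E -> Y.

Definition completion_ext (x : completion E) : Y :=
  lim (T (repr x n) @[n --> \oo]).

Hypothesis lT : linear T.
Variable k : R.
Hypothesis kT : forall x, rnorm (T x) <= k * seminorm x.

Lemma completion_ext_cvg (u : cauchy_sequence E) :
  T (u n) @[n --> \oo] --> completion_ext (completion_of u).
Proof.
have k1 x : rnorm (T x) <= (`|k| + 1) * seminorm x.
  rewrite (le_trans (kT x))// ler_wpM2r ?seminorm_ge0//.
  by rewrite (le_trans (ler_norm _))// lerDl.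
have k0 : 0 < `|k| + 1 by rewrite ltr_wpDl.
have cv (v : cauchy_sequence E) :
    T (v n) @[n --> \oo] --> lim (T (v n) @[n --> \oo]).
  apply: rcauchy_cvg => e e0.
  have /(cauchy_seqP v)[N NP] : 0 < e / (`|k| + 1) by rewrite divr_gt0.
  exists N => m n Nm Nn; rewrite -(linB lT) (le_lt_trans (k1 _))//.
  by rewrite mulrC -ltr_pdivlMr// NP.
have cr := cv (repr (completion_of u)).
apply/rcvgP => e e0; have e20 : 0 < e / 2 by rewrite divr_gt0.
have /rcvgP/(_ _ e20) h1 := cr.
have h2 : \forall n \near \oo,
    seminorm (repr (completion_of u) n - u n) < (e / 2) / (`|k| + 1).
  have /cvgrPdist_lt/(_ ((e / 2) / (`|k| + 1))) := @completion_repr R E u.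
  move=> /(_ (divr_gt0 e20 k0)); apply: filterS => n.
  by rewrite sub0r normrN ger0_norm// seminorm_ge0.
near=> n.
rewrite -[completion_ext _](subrK (T (repr (completion_of u) n))) -addrA.
rewrite (le_lt_trans (ler_rnormD _ _))// [ltRHS]splitr ltrD//.
  by near: n.
rewrite -(linB lT) (le_lt_trans (k1 _))// mulrC -ltr_pdivlMr//.
by near: n.
Unshelve. all: by end_near. Qed.

Lemma completion_ext_ofE (u : cauchy_sequence E) y :
  T (u n) @[n --> \oo] --> y -> completion_ext (completion_of u) = y.
Proof.
move=> /(cvg_lim (@norm_hausdorff _ Y)) <-.
by apply/esym/(cvg_lim (@norm_hausdorff _ Y)); exact: completion_ext_cvg.
Qed.

Lemma completion_ext_embed x : completion_ext (completion_embed x) = T x.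
Proof. apply: completion_ext_ofE.
by apply: cvg_cst; exact: eventually_filter. Qed.

Lemma completion_ext_lin : linear completion_ext.
Proof.
move=> a; elim/completion_ind => u; elim/completion_ind => v.
rewrite -completion_of_scale -completion_of_add; apply: completion_ext_ofE.
rewrite (_ : (fun n => _) = fun n => a *: T (u n) + T (v n)).
  by apply: cvgD; [apply: cvgZr|]; exact: completion_ext_cvg.
by apply/funext => n /=; rewrite lT.
Qed.

Lemma completion_ext_le x : rnorm (completion_ext x) <= k * rnorm x.
Proof.
elim/completion_ind: x => u.
have h : rnorm (T (u n)) @[n --> \oo] --> rnorm (completion_ext (completion_of u)).
  apply/cvgrPdist_lt => e e0; have /rcvgP/(_ _ e0) := @completion_ext_cvg u.
  apply: filterS => n; apply: le_lt_trans; rewrite ler_norml.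
  have := ler_rnormD (completion_ext (completion_of u) - T (u n)) (T (u n)).
  have := ler_rnormD (T (u n) - completion_ext (completion_of u))
    (completion_ext (completion_of u)).
  by rewrite !subrK [rnorm (T (u n) - _)]rnormB => ? ?; apply/andP; split; lra.
apply: (@ler_cvg_to nat \oo _ _ (fun n => rnorm (T (u n))) (fun n => k * seminorm (u n))).
- exact: h.
- by apply: cvgMl_tmp; exact: completion_norm_cvg.
- by apply: nearW => n; exact: kT.
Qed.

Lemma completion_ext_bdd : bounded_op completion_ext.
Proof. by exists k; exact: completion_ext_le. Qed.

End CompletionExtension.

Section ProjectiveTensorProduct.
Variables (R : realType) (X Y : normedModType R[i]).

Definition proj_cost (s : seq (X * Y)) : R :=
  \sum_(q <- s) rnorm q.1 * rnorm q.2.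

Definition projnorm (t : tensor X Y) : R :=
  inf [set proj_cost s | s in [set s | tensor_of s = t]].

Lemma proj_cost_ge0 s : 0 <= proj_cost s.
Proof. by apply: sumr_ge0 => q _; rewrite mulr_ge0 ?rnorm_ge0. Qed.

Lemma projnorm_has_inf t : has_inf [set proj_cost s | s in [set s | tensor_of s = t]].
Proof.
split; first by exists (proj_cost (repr t)), (repr t) => //=; exact: tensor_reprK.
by exists 0 => _ [s _ <-]; exact: proj_cost_ge0.
Qed.

Lemma projnorm_le s : projnorm (tensor_of s) <= proj_cost s.
Proof.
by apply: ge_inf; [exact: (projnorm_has_inf _).2|exists s].
Qed.

Lemma projnorm_ge t (r : R) :
  (forall s, tensor_of s = t -> r <= proj_cost s) -> r <= projnorm t.
Proof.
move=> h; apply: lb_le_inf; first exact: (projnorm_has_inf _).1.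
by move=> _ [s st <-]; exact: h.
Qed.

Lemma projnorm_approx t (e : R) : 0 < e ->
  exists2 s, tensor_of s = t & proj_cost s < projnorm t + e.
Proof.
move=> e0; have [_ [s st <-] lt] := inf_adherent e0 (projnorm_has_inf t).
by exists s.
Qed.

Lemma projnormD t t' : projnorm (t + t') <= projnorm t + projnorm t'.
Proof.
apply/ler_addgt0Pl => e e0; have e20 : 0 < e / 2 by rewrite divr_gt0.
have [s <- hs] := projnorm_approx t e20; have [s' <- hs'] := projnorm_approx t' e20.
rewrite -tensor_of_cat (le_trans (projnorm_le _))//.
rewrite /proj_cost big_cat/= -!/(proj_cost _); lra.
Qed.

Lemma proj_cost_scale a s :
  proj_cost (scale_seq a s) = rnorm (a : R[i]^o) * proj_cost s.
Proof.
rewrite /proj_cost big_map mulr_sumr; apply: eq_bigr => q _.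
by rewrite rnormZ mulrA.
Qed.

Lemma projnormZ_le a t : projnorm (a *: t) <= rnorm (a : R[i]^o) * projnorm t.
Proof.
have [->|a0] := eqVneq a 0.
  rewrite scale0r rnorm0 mul0r (le_trans (projnorm_le [::]))//.
  by rewrite /proj_cost big_nil.
have r0 : 0 < rnorm (a : R[i]^o).
  rewrite lt_neqAle rnorm_ge0 andbT eq_sym; apply: contra a0 => /eqP.
  by move=> /rnorm0_eq0 ->.
rewrite mulrC -ler_pdivrMr//; apply: projnorm_ge => s <-.
rewrite ler_pdivrMr// mulrC -proj_cost_scale -tensor_of_scale.
exact: projnorm_le.
Qed.

Lemma rnorm_inv (a : R[i]) : a != 0 -> rnorm (a^-1 : R[i]^o) = (rnorm (a : R[i]^o))^-1.
Proof.
move=> a0; have h : rnorm (a : R[i]^o) * rnorm (a^-1 : R[i]^o) = 1.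
  rewrite -rnormZ /GRing.scale/= mulfV//.
  by rewrite -(rnorm_real (@ler01 R)).
by rewrite -[RHS]mulr1 -h mulKf//; apply/eqP => r0; move: h; rewrite r0 mul0r => /esym/eqP; rewrite oner_eq0.
Qed.

Lemma projnormZ a t : projnorm (a *: t) = rnorm (a : R[i]^o) * projnorm t.
Proof.
apply/eqP; rewrite eq_le projnormZ_le/=.
have [->|a0] := eqVneq a 0.
  rewrite rnorm0 mul0r; apply: projnorm_ge => s _; exact: proj_cost_ge0.
have r0 : 0 < rnorm (a : R[i]^o).
  rewrite lt_neqAle rnorm_ge0 andbT eq_sym; apply: contra a0 => /eqP.
  by move=> /rnorm0_eq0 ->.
rewrite -ler_pdivlMl// -rnorm_inv// (le_trans _ (projnormZ_le _ _))//.
by rewrite scalerA mulVf// scale1r.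
Qed.

(* projnorm is in fact a norm, but the completion only needs a seminorm. *)
Definition tensor_proj : seminormedModType R :=
  SeminormedModType projnormD projnormZ.

Definition ptensor : completeNormedModType R[i] := completion tensor_proj.

Definition ptens (x : X) (y : Y) : ptensor :=
  completion_embed (tens x y : tensor_proj).

Lemma ptens_bilinear : bilinear_for *:%R *:%R ptens.
Proof.
have [h1 h2] := tens_bilinear X Y.
split=> [v a x y|u a x y]; rewrite /ptens.
  by rewrite [tens _ _](h1 v); exact: completion_embed_lin.
by rewrite [tens _ _](h2 u); exact: completion_embed_lin.
Qed.

Lemma rnorm_ptens_le x y : rnorm (ptens x y) <= rnorm x * rnorm y.
Proof.
rewrite rnorm_completion_embed (le_trans (projnorm_le _))//.
by rewrite /proj_cost big_seq1.
Qed.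

Lemma ptensor_dense (z : ptensor) (e : R) : 0 < e ->
  exists s : seq (X * Y), rnorm (z - \sum_(q <- s) ptens q.1 q.2) < e.
Proof.
move=> /(completion_dense z)[t tz]; exists (repr (t : tensor X Y)).
suff <- : completion_embed (t : tensor_proj) =
    \sum_(q <- repr (t : tensor X Y)) ptens q.1 q.2 by [].
rewrite -[in LHS](tensor_reprK (t : tensor X Y)) tensor_of_sum.
elim: (repr _) => [|q s IH]; first by rewrite !big_nil (lin0 (@completion_embed_lin _ _)).
by rewrite !big_cons -IH -(linD (@completion_embed_lin _ _)).
Qed.

End ProjectiveTensorProduct.

Section BoundedBilinear.
Variables (R : realType) (X Y : normedModType R[i]).

Definition bounded_bilin (Z : normedModType R[i]) (f : X -> Y -> Z) :=
  exists k : R, forall x y, rnorm (f x y) <= k * (rnorm x * rnorm y).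

Variable Z : completeNormedModType R[i].
Implicit Types f : X -> Y -> Z.

(* The linearization of f, with ptensor_lift f (ptens x y) = f x y. *)
Definition ptensor_lift_fun f : ptensor X Y -> Z :=
  completion_ext (tensor_lift f : tensor_proj X Y -> Z).

Lemma tensor_lift_le f (k : R) : bilinear_for *:%R *:%R f -> 0 <= k ->
  (forall x y, rnorm (f x y) <= k * (rnorm x * rnorm y)) ->
  forall t, rnorm (tensor_lift f t) <= k * projnorm t.
Proof.
move=> bf k0 kf t; apply/ler_addgt0Pl => e e0.
have k1 : 0 < k + 1 by rewrite ltr_wpDl.
have [s <- hs] := projnorm_approx t (divr_gt0 e0 k1).
rewrite tensor_liftE// (le_trans (ler_rnorm_sum _ _))//.
apply: (@le_trans _ _ (k * proj_cost s)).
  by rewrite /proj_cost mulr_sumr; apply: ler_sum => q _; exact: kf.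
apply: (@le_trans _ _ (k * (projnorm (tensor_of s) + e / (k + 1)))).
  by rewrite ler_wpM2l// ltW.
rewrite mulrDr addrC lerD2r mulrCA ler_piMr ?(ltW e0)//.
by rewrite ler_pdivrMr// mul1r lerDl.
Qed.

Lemma bounded_bilin_pos (f : X -> Y -> Z) : bounded_bilin f ->
  exists2 k : R, 0 <= k & forall x y, rnorm (f x y) <= k * (rnorm x * rnorm y).
Proof.
move=> [k kP]; exists `|k| => // x y.
by rewrite (le_trans (kP x y))// ler_wpM2r ?mulr_ge0 ?rnorm_ge0// ler_norm.
Qed.

Section Lift.
Variable f : X -> Y -> Z.
Hypothesis bf : bilinear_for *:%R *:%R f.
Hypothesis cf : bounded_bilin f.

Lemma ptensor_lift_lin : linear (ptensor_lift_fun f).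
Proof.
have [k k0 kP] := bounded_bilin_pos cf.
exact: (@completion_ext_lin R (tensor_proj X Y) Z _ (tensor_lift_lin bf) k
  (tensor_lift_le bf k0 kP)).
Qed.

Lemma ptensor_lift_bdd : bounded_op (ptensor_lift_fun f).
Proof.
have [k k0 kP] := bounded_bilin_pos cf.
exact: (@completion_ext_bdd R (tensor_proj X Y) Z _ (tensor_lift_lin bf) k
  (tensor_lift_le bf k0 kP)).
Qed.

Definition ptensor_lift : bop (ptensor X Y) Z := Bop ptensor_lift_lin ptensor_lift_bdd.

Lemma ptensor_lift_ptens x y : ptensor_lift (ptens x y) = f x y.
Proof.
have [k k0 kP] := bounded_bilin_pos cf.
rewrite /= /ptensor_lift_fun.
rewrite (@completion_ext_embed R (tensor_proj X Y) Z _ (tensor_lift_lin bf) k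
  (tensor_lift_le bf k0 kP)).
exact: tensor_lift_tens.
Qed.

Lemma ptensor_lift_le (k : R) : 0 <= k ->
  (forall x y, rnorm (f x y) <= k * (rnorm x * rnorm y)) ->
  forall z, rnorm (ptensor_lift z) <= k * rnorm z.
Proof.
move=> k0 kP.
move=> z; exact: (@completion_ext_le R (tensor_proj X Y) Z _ (tensor_lift_lin bf) k
  (tensor_lift_le bf k0 kP)).
Qed.

End Lift.
End BoundedBilinear.

(* Algebras are not assumed unital. *)
HB.mixin Record isBanachAlgebra (R : realType) A & CompleteNormedModule R[i] A := {
  bmul : A -> A -> A;
  bmulA : associative bmul;
  bmul_bilinear : bilinear_for *:%R *:%R bmul;
  normr_bmul : forall a b : A, `|bmul a b| <= `|a| * `|b| }.

#[short(type="banachAlgType")]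
HB.structure Definition BanachAlgebra (R : realType) :=
  {A of CompleteNormedModule R[i] A & isBanachAlgebra R A}.

Section BanachAlgebraTheory.
Variables (R : realType) (A : banachAlgType R).
Implicit Types a b x y : A.

Lemma rnorm_bmul a b : rnorm (bmul a b) <= rnorm a * rnorm b.
Proof. by rewrite -lecR rmorphM/= -!normE normr_bmul. Qed.

Lemma bmull_lin a : linear (fun x => bmul a x).
Proof. exact: (bmul_bilinear (s := A)).2. Qed.

Lemma bmulr_lin a : linear (fun x => bmul x a).
Proof. exact: (bmul_bilinear (s := A)).1. Qed.

Lemma bmull_bdd a : bounded_op (fun x => bmul a x).
Proof. by exists (rnorm a) => x; exact: rnorm_bmul. Qed.

Lemma bmulr_bdd a : bounded_op (fun x => bmul x a).
Proof. by exists (rnorm a) => x; rewrite mulrC; exact: rnorm_bmul. Qed.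

Definition bmull a : bop A A := Bop (@bmull_lin a) (@bmull_bdd a).
Definition bmulr a : bop A A := Bop (@bmulr_lin a) (@bmulr_bdd a).

Lemma bmul_bdd : bounded_bilin (@bmul R A).
Proof. by exists 1 => x y; rewrite mul1r; exact: rnorm_bmul. Qed.

Definition product_map : bop (ptensor A A) A :=
  ptensor_lift (bmul_bilinear (s := A)) bmul_bdd.

Lemma lact_bilinear a : bilinear_for *:%R *:%R (fun x y => ptens (bmul a x) y).
Proof.
split=> [y c x x'|x c y y'].
  by rewrite (bmull_lin a); exact: (ptens_bilinear A A).1.
exact: (ptens_bilinear A A).2.
Qed.

Lemma lact_bdd a : bounded_bilin (fun x y => ptens (bmul a x) y).
Proof.
exists (rnorm a) => x y; rewrite (le_trans (rnorm_ptens_le _ _))// mulrA.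
by rewrite ler_wpM2r ?rnorm_ge0 ?rnorm_bmul.
Qed.

Lemma ract_bilinear a : bilinear_for *:%R *:%R (fun x y => ptens x (bmul y a)).
Proof.
split=> [y c x x'|x c y y']; first exact: (ptens_bilinear A A).1.
by rewrite (bmulr_lin a); exact: (ptens_bilinear A A).2.
Qed.

Lemma ract_bdd a : bounded_bilin (fun x y => ptens x (bmul y a)).
Proof.
exists (rnorm a) => x y; rewrite (le_trans (rnorm_ptens_le _ _))// mulrCA.
by rewrite ler_wpM2l ?rnorm_ge0// mulrC rnorm_bmul.
Qed.

(* u |-> a . u and u |-> u . a on the projective tensor square of A *)
Definition tensor_lact a : bop (ptensor A A) (ptensor A A) :=
  ptensor_lift (lact_bilinear a) (lact_bdd a).
Definition tensor_ract a : bop (ptensor A A) (ptensor A A) :=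
  ptensor_lift (ract_bilinear a) (ract_bdd a).

Lemma product_mapE x y : product_map (ptens x y) = bmul x y.
Proof. exact: ptensor_lift_ptens. Qed.

Lemma tensor_lactE a x y : tensor_lact a (ptens x y) = ptens (bmul a x) y.
Proof. exact: ptensor_lift_ptens. Qed.

Lemma tensor_ractE a x y : tensor_ract a (ptens x y) = ptens x (bmul y a).
Proof. exact: ptensor_lift_ptens. Qed.

End BanachAlgebraTheory.

Definition second_adj (R : realType) (X Y : normedModType R[i]) (T : bop X Y) :
  bop (dual (dual X)) (dual (dual Y)) := adj (adj T).

(* The bidual of a bimodule carries the second adjoints of the actions, that
   is, (a . M) f = M (f . a) with (f . a) x = f (a . x), and symmetrically. *)
Definition virtual_diagonal (R : realType) (A : banachAlgType R)
    (M : dual (dual (ptensor A A))) : Prop :=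
  (forall a, second_adj (tensor_lact a) M = second_adj (tensor_ract a) M) /\
  (forall a,
     second_adj (bmull a) (second_adj (product_map A) M) = eval_dual a /\
     second_adj (bmulr a) (second_adj (product_map A) M) = eval_dual a).

Definition amenable (R : realType) (A : banachAlgType R) : Prop :=
  exists M, @virtual_diagonal R A M.

(* The infimum of the empty set is +oo. *)
Definition AM (R : realType) (A : banachAlgType R) : \bar R :=
  ereal_inf [set (rnorm M)%:E | M in @virtual_diagonal R A].

Lemma AM_not_amenable (R : realType) (A : banachAlgType R) :
  ~ amenable A -> AM A = +oo%E.
Proof.
move=> nA; rewrite /AM (_ : [set _ | _ in _] = set0) ?ereal_inf0//.
by rewrite -subset0 => x [M vM _]; apply: nA; exists M.
Qed.

Section C0Sum.
Variables (R : realType) (I : Type) (A : I -> banachAlgType R).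

(* The family of norms belongs to c_0(I). *)
Definition vanishes_at_infinity (a : forall i, A i) : Prop :=
  forall e : R, 0 < e -> finite_set [set i | e <= rnorm (a i)].

Record c0sum := C0sum {
  c0sum_fun :> forall i, A i;
  c0sumP : vanishes_at_infinity c0sum_fun }.

HB.instance Definition _ := gen_eqMixin c0sum.
HB.instance Definition _ := gen_choiceMixin c0sum.

Implicit Types a b : c0sum.

Lemma c0sum_ext a b : (forall i, a i = b i) -> a = b.
Proof.
case: a b => [a ha] [b hb]/= ab.
have {}ab : a = b by apply: functional_extensionality_dep.
by subst b; congr C0sum; exact: Prop_irrelevance.
Qed.

Lemma c0_zero_subproof : vanishes_at_infinity (fun i => 0).
Proof.
move=> e e0; rewrite (_ : [set _ | _] = set0); first exact: finite_set0.
by rewrite -subset0 => i /=; rewrite rnorm0 leNgt e0.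
Qed.

Lemma c0_add_subproof a b : vanishes_at_infinity (fun i => a i + b i).
Proof.
move=> e e0; have e20 : 0 < e / 2 by rewrite divr_gt0.
have h : finite_set ([set i | e / 2 <= rnorm (a i)] `|`
                     [set i | e / 2 <= rnorm (b i)]).
  by rewrite finite_setU; split; exact: c0sumP.
apply: sub_finite_set h => i /= ei.
have [?|ai] := leP (e / 2) (rnorm (a i)); [by left|right].
have := ler_rnormD (a i) (b i); lra.
Qed.

Lemma c0_scale_subproof (c : R[i]) a : vanishes_at_infinity (fun i => c *: a i).
Proof.
move=> e e0; have c1 : 0 < rnorm (c : R[i]^o) + 1 by rewrite ltr_wpDl ?rnorm_ge0.
apply: sub_finite_set (c0sumP a (divr_gt0 e0 c1)) => i /=.
rewrite rnormZ => ei; rewrite ler_pdivrMr// (le_trans ei)// mulrC.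
by rewrite ler_wpM2l ?rnorm_ge0// lerDl.
Qed.

Definition c0_zero := C0sum c0_zero_subproof.
Definition c0_add a b := C0sum (c0_add_subproof a b).
Definition c0_scale (c : R[i]) a := C0sum (c0_scale_subproof c a).

Lemma c0_addA : associative c0_add.
Proof. by move=> a b c; apply: c0sum_ext => i /=; rewrite addrA. Qed.
Lemma c0_addC : commutative c0_add.
Proof. by move=> a b; apply: c0sum_ext => i /=; rewrite addrC. Qed.
Lemma c0_add0 : left_id c0_zero c0_add.
Proof. by move=> a; apply: c0sum_ext => i /=; rewrite add0r. Qed.
Lemma c0_addN : left_inverse c0_zero (c0_scale (-1)) c0_add.
Proof. by move=> a; apply: c0sum_ext => i /=; rewrite scaleN1r addNr. Qed.

HB.instance Definition _ := GRing.isZmodule.Build c0sum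
  c0_addA c0_addC c0_add0 c0_addN.

Lemma c0_scaleA c d a : c0_scale c (c0_scale d a) = c0_scale (c * d) a.
Proof. by apply: c0sum_ext => i /=; rewrite scalerA. Qed.
Lemma c0_scale1 : left_id 1 c0_scale.
Proof. by move=> a; apply: c0sum_ext => i /=; rewrite scale1r. Qed.
Lemma c0_scaleDr : right_distributive c0_scale +%R.
Proof. by move=> c a b; apply: c0sum_ext => i /=; rewrite scalerDr. Qed.
Lemma c0_scaleDl a c d : c0_scale (c + d) a = c0_scale c a + c0_scale d a.
Proof. by apply: c0sum_ext => i /=; rewrite scalerDl. Qed.

HB.instance Definition _ := GRing.Zmodule_isLmodule.Build R[i] c0sum
  c0_scaleA c0_scale1 c0_scaleDr c0_scaleDl.

Lemma c0sumDE a b i : (a + b) i = a i + b i. Proof. by []. Qed.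
Lemma c0sumZE (c : R[i]) a i : (c *: a) i = c *: a i. Proof. by []. Qed.
Lemma c0sumBE a b i : (a - b) i = a i - b i.
Proof. by rewrite -[LHS]/(a i + -1 *: b i) scaleN1r. Qed.

Definition c0norm a : R := sup [set rnorm (a i) | i in [set: I]].

Lemma c0norm_has_ubound a : has_ubound [set rnorm (a i) | i in [set: I]].
Proof.
have /(finite_image (fun i => rnorm (a i))) := c0sumP a (@ltr01 R).
move=> /finite_seqP[s sE].
exists (1 + \sum_(x <- s) `|x|) => _ [i _ <-].
have s0 : 0 <= \sum_(x <- s) `|x| by apply: sumr_ge0.
have [ai|ai] := leP 1 (rnorm (a i)); last by rewrite (le_trans (ltW ai))// lerDl.
have : [set rnorm (a i) | i in [set i | 1 <= rnorm (a i)]] (rnorm (a i)) by exists i.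
rewrite sE /= => si; rewrite (big_rem _ si)/= ler_wpDl// ler_wpDr ?ler_norm//.
by apply: sumr_ge0.
Qed.

Lemma c0norm_ub a i : rnorm (a i) <= c0norm a.
Proof. by apply: sup_ubound; [exact: c0norm_has_ubound|exists i]. Qed.

Lemma c0norm_le a (k : R) : 0 <= k -> (forall i, rnorm (a i) <= k) -> c0norm a <= k.
Proof.
move=> k0 kP; rewrite /c0norm; have [->|/set0P ne] := eqVneq [set rnorm (a i) | i in [set: I]] set0.
  by rewrite sup0.
by apply: ge_sup => // _ [i _ <-].
Qed.

Lemma c0norm_ge0 a : 0 <= c0norm a.
Proof.
rewrite /c0norm; have [->|/set0P] := eqVneq [set rnorm (a i) | i in [set: I]] set0.
  by rewrite sup0.
move=> [_ [i _ _]]; exact: le_trans (rnorm_ge0 (a i)) (c0norm_ub a i).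
Qed.

Lemma c0normD a b : (c0norm (a + b))%:C <= (c0norm a)%:C + (c0norm b)%:C.
Proof.
rewrite -rmorphD lecR; apply: c0norm_le; first by rewrite addr_ge0 ?c0norm_ge0.
by move=> i; rewrite c0sumDE (le_trans (ler_rnormD _ _))// lerD ?c0norm_ub.
Qed.

Lemma c0normZ_le (c : R[i]) a : c0norm (c *: a) <= rnorm (c : R[i]^o) * c0norm a.
Proof.
apply: c0norm_le; first by rewrite mulr_ge0 ?c0norm_ge0 ?rnorm_ge0.
by move=> i; rewrite c0sumZE rnormZ ler_wpM2l ?rnorm_ge0 ?c0norm_ub.
Qed.

Lemma c0normZ (c : R[i]) a : (c0norm (c *: a))%:C = `|c| * (c0norm a)%:C.
Proof.
rewrite [`|c|](normE (c : R[i]^o)) -rmorphM/=; congr (_%:C); apply/eqP.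
rewrite eq_le c0normZ_le/=.
have [->|c0] := eqVneq c 0; first by rewrite rnorm0 mul0r c0norm_ge0.
have r0 : 0 < rnorm (c : R[i]^o).
  rewrite lt_neqAle rnorm_ge0 andbT eq_sym; apply: contra c0 => /eqP.
  by move=> /rnorm0_eq0 ->.
rewrite -ler_pdivlMl// -rnorm_inv// (le_trans _ (c0normZ_le _ _))//.
by rewrite scalerA mulVf// scale1r.
Qed.

Lemma c0norm0_eq0 a : (c0norm a)%:C = 0 :> R[i] -> a = 0.
Proof.
move=> [a0]; apply: c0sum_ext => i; apply: rnorm0_eq0; apply/eqP.
by rewrite eq_le rnorm_ge0 andbT -a0 c0norm_ub.
Qed.

HB.instance Definition _ := Lmodule_isNormed.Build R[i] c0sum
  c0normD c0normZ c0norm0_eq0.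

Lemma c0sum_rnormE a : rnorm a = c0norm a. Proof. by []. Qed.

Lemma c0sum_complete (F : set_system c0sum) : ProperFilter F -> cauchy F -> cvg F.
Proof.
apply: rcomplete => u cu.
have ci i : rcauchy (fun n => u n i).
  move=> e e0; have [N NP] := cu e e0; exists N => m n Nm Nn.
  by rewrite (le_lt_trans _ (NP _ _ Nm Nn))// -c0sumBE c0norm_ub.
pose l i : A i := lim (u n i @[n --> \oo]).
have ul i : u n i @[n --> \oo] --> l i by apply: rcauchy_cvg; exact: ci.
have unif (e : R) : 0 < e -> exists N, forall n i, (N <= n)%N ->
    rnorm (l i - u n i) <= e.
  move=> e0; have [N NP] := cu _ e0; exists N => n i Nn.
  apply/ler_addgt0Pl => d d0.
  have [M _ MP] := (rcvgP _ _).1 (ul i) _ d0.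
  have h1 := MP (maxn M N) (leq_maxl _ _).
  have h2 := NP _ _ (leq_maxr M N) Nn.
  have h3 := c0norm_ub (u (maxn M N) - u n) i.
  rewrite c0sumBE in h3.
  rewrite -[l i](subrK (u (maxn M N) i)) -addrA (le_trans (ler_rnormD _ _))//.
  rewrite lerD ?ltW//; exact: (le_lt_trans h3 h2).
have lc0 : vanishes_at_infinity l.
  move=> e e0; have e20 : 0 < e / 2 by rewrite divr_gt0.
  have [N NP] := unif _ e20.
  apply: sub_finite_set (c0sumP (u N) e20) => i /= ei.
  have := ler_rnormD (l i - u N i) (u N i); rewrite subrK.
  have := NP N i (leqnn _); lra.
exists (C0sum lc0); apply/rcvgP => e e0; have e20 : 0 < e / 2 by rewrite divr_gt0.
have [N NP] := unif _ e20; exists N => // n /= Nn.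
rewrite c0sum_rnormE (@le_lt_trans _ _ (e / 2))//.
  by apply: c0norm_le => [|i]; [exact: ltW|rewrite c0sumBE NP].
by rewrite ltr_pdivrMr// ltr_pMr// ltr1n.
Qed.

HB.instance Definition _ := Uniform_isComplete.Build c0sum c0sum_complete.

Lemma c0_mul_subproof a b : vanishes_at_infinity (fun i => bmul (a i) (b i)).
Proof.
move=> e e0; have c1 : 0 < c0norm b + 1 by rewrite ltr_wpDl ?c0norm_ge0.
apply: sub_finite_set (c0sumP a (divr_gt0 e0 c1)) => i /= ei.
rewrite ler_pdivrMr// (le_trans ei)// (le_trans (rnorm_bmul _ _))//.
by rewrite ler_wpM2l ?rnorm_ge0// (le_trans (c0norm_ub b i))// lerDl.
Qed.

Definition c0_mul a b := C0sum (c0_mul_subproof a b).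

Lemma c0_mulA : associative c0_mul.
Proof. by move=> a b c; apply: c0sum_ext => i /=; rewrite bmulA. Qed.

Lemma c0_mul_bilinear : bilinear_for *:%R *:%R c0_mul.
Proof.
split=> [b c x y|a c x y]; apply: c0sum_ext => i /=.
  exact: (bmulr_lin (b i)).
exact: (bmull_lin (a i)).
Qed.

Lemma c0_normM a b : `|c0_mul a b| <= `|a| * `|b|.
Proof.
rewrite !normE -rmorphM lecR; apply: c0norm_le.
  by rewrite mulr_ge0 ?rnorm_ge0.
move=> i /=; rewrite (le_trans (rnorm_bmul _ _))//.
by rewrite ler_pM ?rnorm_ge0// c0norm_ub.
Qed.

HB.instance Definition _ := isBanachAlgebra.Build R c0sum
  c0_mulA c0_mul_bilinear c0_normM.

End C0Sum.

(* Main.v *)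
(* A virtual diagonal of A is pushed forward along the coordinate projection
   A -> A_i, which gives AM(A_i) <= AM(A).  Conversely, let M_i be a virtual
   diagonal of A_i with |M_i| <= k, and for f in the dual of A (x) A let f_i be
   its restriction to A_i (x) A_i.  Averaging f over the signs of the coordinates
   of (sum x_i) (x) (sum y_i) leaves the diagonal blocks only, so that
   sum_i |f_i| <= |f|.  Hence M f := sum_i M_i f_i converges absolutely and
   |M| <= k; no weak* limit is needed. *)

From HB Require Import structures.
Require Import Defs.
From mathcomp Require Import all_boot all_order all_algebra.
From mathcomp Require Import complex finmap.
From mathcomp Require Import all_classical all_reals.
From mathcomp Require Import ereal topology normedtype sequences.
From mathcomp Require Import lra.
From mathcomp.analysis Require Import showcase.summability.

Set Implicit Arguments.
Unset Strict Implicit.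
Unset Printing Implicit Defensive.

Import Order.TTheory GRing.Theory Num.Theory.
Import numFieldNormedType.Exports.

Local Open Scope classical_set_scope.
Local Open Scope complex_scope.
Local Open Scope ring_scope.
#[local] Existing Instance totally_filter.

(** * Completeness of the complex field *)

Section ComplexComplete.
Variable R : realType.

Lemma normr_Re_le (z : R[i]^o) : `|complex.Re z| <= rnorm z.
Proof. by rewrite -lecR -normE normc_ge_Re. Qed.

Lemma normr_Im_le (z : R[i]^o) : `|complex.Im z| <= rnorm z.
Proof.
rewrite -lecR -normE normc_def lecR -sqrtr_sqr ler_wsqrtr// lerDr.
exact: sqr_ge0.
Qed.

Lemma rnorm_le_ReIm (z : R[i]^o) : rnorm z <= `|complex.Re z| + `|complex.Im z|.
Proof.
rewrite -lecR -normE normc_def lecR -[leRHS]ger0_norm ?addr_ge0//.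
rewrite -sqrtr_sqr ler_wsqrtr// sqrrD !real_normK ?num_real//.
by rewrite addrAC lerDl mulrn_wge0// mulr_ge0.
Qed.

(* The library already registers completeness for the regular module [R^o] over
   a [realType] [R], which blocks a second instance on [R[i]^o]. *)
Definition cplx : Type := R[i]^o.
HB.instance Definition _ := NormedModule.copy cplx R[i]^o.

Lemma complex_complete (F : set_system cplx) :
  ProperFilter F -> cauchy F -> cvg F.
Proof.
apply: rcomplete => u cu.
(* Covers the real and the imaginary part at once: an additive map dominated by the norm sends
   Cauchy sequences to Cauchy sequences. *)
have part (p : R[i] -> R) : (forall x y, p (x - y) = p x - p y) ->
    (forall z : R[i]^o, `|p z| <= rnorm z) ->
    p (u n) @[n --> \oo] --> lim (p (u n) @[n --> \oo]).
  move=> pB ple; apply: real_cauchy_cvg => e /cu[N NP].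
  by exists N => m n Nm Nn; rewrite -pB (le_lt_trans (ple _))// NP.
have cRe := part _ (fun x y => raddfB (@complex.Re R) x y) normr_Re_le.
have cIm := part _ (fun x y => raddfB (@complex.Im R) x y) normr_Im_le.
set a := lim _ in cRe; set b := lim _ in cIm.
exists (a +i* b); apply/rcvgP => e e0.
have e20 : 0 < e / 2 by rewrite divr_gt0.
near=> n; apply: le_lt_trans (rnorm_le_ReIm _) _.
rewrite [ltRHS]splitr !raddfB/= ltrD//; near: n.
- by move/cvgrPdist_lt: cRe; exact.
- by move/cvgrPdist_lt: cIm; exact.
Unshelve. all: by end_near. Qed.

HB.instance Definition _ := Uniform_isComplete.Build cplx complex_complete.

End ComplexComplete.

(** * Functionals on the projective tensor product *)

Section PTensorTheory.
Variables (R : realType) (X Y : normedModType R[i]).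

(** Finite sums of elementary tensors are dense and [f - g] is bounded. *)
Lemma ptensor_ext (Z : normedModType R[i]) (f g : bop (ptensor X Y) Z) :
  (forall x y, f (ptens x y) = g (ptens x y)) -> f = g.
Proof.
move=> fg; apply: bopP => z; apply/eqP; rewrite -subr_eq0; apply/eqP.
apply: rnorm0_eq0; apply/eqP; rewrite eq_le rnorm_ge0 andbT.
(* Adding 1 keeps the divisor of [e] positive even if the norm vanishes. *)
have k0 : 0 < opnorm (f - g) + 1 by rewrite ltr_wpDl ?opnorm_ge0.
apply/ler_addgt0Pl => e e0; rewrite addr0.
have [s zs] := ptensor_dense z (divr_gt0 e0 k0).
have fgs : (f - g) (\sum_(q <- s) ptens q.1 q.2) = 0.
  elim: s {zs} => [|q s IH]; first by rewrite big_nil (lin0 (bop_lin _)).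
  by rewrite big_cons (linD (bop_lin _)) IH addr0 bopDE bopNE fg subrr.
have -> : f z - g z = (f - g) (z - \sum_(q <- s) ptens q.1 q.2).
  by rewrite (linB (bop_lin _)) fgs subr0 bopDE bopNE.
rewrite (le_trans (opnorm_ub _ _))// (@le_trans _ _ ((opnorm (f - g) + 1) *
  rnorm (z - \sum_(q <- s) ptens q.1 q.2)))//.
  by rewrite ler_wpM2r ?rnorm_ge0 ?lerDl.
by rewrite mulrC -ler_pdivlMr// ltW.
Qed.

(** A functional is the linearization of the bilinear form that it induces on pairs, so a bound on
    that form passes to the whole completion. *)
Lemma dual_ptensor_opnorm_le (f : dual (ptensor X Y)) (k : R) : 0 <= k ->
  (forall x y, rnorm (f (ptens x y)) <= k * (rnorm x * rnorm y)) ->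
  opnorm f <= k.
Proof.
(* [ptensor_lift] asks for a complete codomain, hence the values in [cplx R]. *)
move=> k0 fk; pose h x y : cplx R := f (ptens x y).
have bh : bilinear_for *:%R *:%R h.
  have [b1 b2] := ptens_bilinear X Y.
  by split=> [v c x y|u c x y];
    rewrite /h; [rewrite (b1 v)|rewrite (b2 u)]; rewrite (bop_lin f).
have ch : bounded_bilin h by exists k; exact: fk.
have -> : f = ptensor_lift bh ch.
  by apply: ptensor_ext => x y; rewrite ptensor_lift_ptens.
by apply: opnorm_le => // z; exact: (ptensor_lift_le bh ch k0 fk).
Qed.

(** Real parts suffice: a unimodular factor put on [x] turns the value at an elementary tensor into
    its modulus, and rescaling brings both vectors into the unit ball. *)
Lemma dual_ptensor_Re_le (f : dual (ptensor X Y)) (k : R) : 0 <= k ->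
  (forall x y, rnorm x <= 1 -> rnorm y <= 1 -> complex.Re (f (ptens x y)) <= k) ->
  opnorm f <= k.
Proof.
move=> k0 fk; apply: dual_ptensor_opnorm_le => // x y.
have [b1 b2] := ptens_bilinear X Y.
have [x0|x0] := eqVneq x 0.
  by rewrite x0 (lin0 (b1 y)) (lin0 (bop_lin f)) !rnorm0 mul0r mulr0.
have [y0|y0] := eqVneq y 0.
  by rewrite y0 (lin0 (b2 x)) (lin0 (bop_lin f)) !rnorm0 mulr0 mulr0.
set c := f (ptens x y); have [->|c0] := eqVneq c 0.
  by rewrite rnorm0 !mulr_ge0 ?rnorm_ge0.
have rpos (V : normedModType R[i]) (v : V) : v != 0 -> 0 < rnorm v.
  move=> v0; rewrite lt_neqAle rnorm_ge0 andbT eq_sym.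
  by apply: contra v0 => /eqP/rnorm0_eq0 ->.
have xp := rpos _ _ x0; have yp := rpos _ _ y0.
have cp : 0 < rnorm (c : R[i]^o) := rpos _ (c : R[i]^o) c0.
(* Chosen so that [u * c] is the modulus of [c]. *)
pose u : R[i] := (rnorm (c : R[i]^o))%:C / c.
have ru : rnorm (u : R[i]^o) = 1.
  rewrite /u -[_ / _]/(_%:C *: (c^-1 : R[i]^o)) rnormZ rnorm_real ?ltW//.
  by rewrite rnorm_inv// mulfV ?gt_eqF.
have := fk ((u * (rnorm x)^-1%:C) *: x) ((rnorm y)^-1%:C *: y).
rewrite -scalerA rnormZ ru mul1r !rnormZ !rnorm_real ?invr_ge0 ?rnorm_ge0//.
rewrite !mulVf ?gt_eqF// => /(_ (lexx _) (lexx _)).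
rewrite scalerA (linZ (b1 _)) (linZ (b2 _)) !(linZ (bop_lin f)) -/c.
rewrite ![_ *: _ in X in complex.Re X]/GRing.scale/=.
have -> : u * (rnorm x)^-1%:C * ((rnorm y)^-1%:C * c) =
  (rnorm (c : R[i]^o) / (rnorm x * rnorm y))%:C.
  rewrite /u invfM !rmorphM/= mulrCA -!mulrA [c^-1 * _]mulrC -!mulrA mulfV// mulr1.
  by rewrite mulrCA; congr (_ * _); exact: mulrC.
by rewrite /= ler_pdivrMr// mulr_gt0.
Qed.

(** Otherwise the preceding bound would give [opnorm f <= opnorm f - e]. *)
Lemma dual_ptensor_attains (f : dual (ptensor X Y)) (e : R) : 0 < e ->
  exists x y, [/\ rnorm x <= 1, rnorm y <= 1 &
                  opnorm f - e <= complex.Re (f (ptens x y))].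
Proof.
move=> e0; apply: contrapT => /forallNP h.
have [b1 b2] := ptens_bilinear X Y.
have lt x y : rnorm x <= 1 -> rnorm y <= 1 ->
    complex.Re (f (ptens x y)) < opnorm f - e.
  by move=> x1 y1; rewrite ltNge; apply/negP => hxy; apply: (h x); exists y.
(* The preceding bound asks for a nonnegative constant; the pair of zero vectors provides this. *)
have k0 : 0 <= opnorm f - e.
  have := lt 0 0; rewrite !rnorm0 => /(_ ler01 ler01).
  by rewrite (lin0 (b1 0)) (lin0 (bop_lin f)) => /ltW.
have := dual_ptensor_Re_le k0 (fun x y hx hy => ltW (lt x y hx hy)).
by rewrite leNgt ltrBlDr ltrDl e0.
Qed.

End PTensorTheory.

(** * Tensor products of operators, and adjoints *)

Section PTensorMap.
Variables (R : realType) (X X' Y Y' : normedModType R[i]).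
Variables (S : bop X X') (T : bop Y Y').

Lemma ptensor_map_bilinear : bilinear_for *:%R *:%R (fun x y => ptens (S x) (T y)).
Proof.
split=> [y c x x'|x c y y'].
  by rewrite (bop_lin S); exact: (ptens_bilinear X' Y').1.
by rewrite (bop_lin T); exact: (ptens_bilinear X' Y').2.
Qed.

Lemma ptensor_map_le x y :
  rnorm (ptens (S x) (T y)) <= opnorm S * opnorm T * (rnorm x * rnorm y).
Proof.
rewrite (le_trans (rnorm_ptens_le _ _))// mulrACA.
by rewrite ler_pM ?rnorm_ge0 ?opnorm_ub.
Qed.

Definition ptensor_map : bop (ptensor X Y) (ptensor X' Y') :=
  ptensor_lift ptensor_map_bilinear (ex_intro _ _ ptensor_map_le).

Lemma ptensor_mapE x y : ptensor_map (ptens x y) = ptens (S x) (T y).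
Proof. exact: ptensor_lift_ptens. Qed.

Lemma opnorm_ptensor_map : opnorm ptensor_map <= opnorm S * opnorm T.
Proof.
have k0 : 0 <= opnorm S * opnorm T by rewrite mulr_ge0 ?opnorm_ge0.
by apply: opnorm_le => // z; exact: ptensor_lift_le k0 ptensor_map_le z.
Qed.

End PTensorMap.

Lemma opnorm_adj (R : realType) (X Y : normedModType R[i]) (T : bop X Y) :
  opnorm (adj T) <= opnorm T.
Proof.
apply: opnorm_le => [|g]; first exact: opnorm_ge0.
apply: opnorm_le => [|x]; first by rewrite mulr_ge0 ?opnorm_ge0 ?rnorm_ge0.
rewrite adjE (le_trans (opnorm_ub _ _))// bop_rnormE [opnorm T * _]mulrC -mulrA.
by rewrite ler_wpM2l ?opnorm_ge0 ?opnorm_ub.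
Qed.

(** * Virtual diagonals and homomorphisms *)

Section Intertwining.
Variables (R : realType) (A B : banachAlgType R) (h : bop A B).
Hypothesis hM : {morph h : x y / bmul x y}.
Variables (a : A) (b : B).
Local Notation hh := (ptensor_map h h).

(** The compatibility of [a] and [b] is more general than [b = h a]. It serves surjective
    homomorphisms, where [b = h a], and also coordinate embeddings, where [b] is any family, perhaps
    outside the image of [h], and [a] is its coordinate. *)
Lemma adj_tensor_lact (f : dual (ptensor B B)) :
  (forall x, bmul b (h x) = h (bmul a x)) ->
  adj hh (adj (tensor_lact b) f) = adj (tensor_lact a) (adj hh f).
Proof.
move=> bh; apply: ptensor_ext => x y.
by rewrite !adjE ptensor_mapE !tensor_lactE ptensor_mapE bh.
Qed.

Lemma adj_tensor_ract (f : dual (ptensor B B)) :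
  (forall x, bmul (h x) b = h (bmul x a)) ->
  adj hh (adj (tensor_ract b) f) = adj (tensor_ract a) (adj hh f).
Proof.
move=> hb; apply: ptensor_ext => x y.
by rewrite !adjE ptensor_mapE !tensor_ractE ptensor_mapE hb.
Qed.

Lemma adj_product_bmull (g : dual B) :
  (forall x, bmul b (h x) = h (bmul a x)) ->
  adj hh (adj (product_map B) (adj (bmull b) g)) =
  adj (product_map A) (adj (bmull a) (adj h g)).
Proof.
move=> bh; apply: ptensor_ext => x y.
by rewrite !adjE ptensor_mapE !product_mapE /= -hM bh.
Qed.

Lemma adj_product_bmulr (g : dual B) :
  (forall x, bmul (h x) b = h (bmul x a)) ->
  adj hh (adj (product_map B) (adj (bmulr b) g)) =
  adj (product_map A) (adj (bmulr a) (adj h g)).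
Proof.
move=> hb; apply: ptensor_ext => x y.
by rewrite !adjE ptensor_mapE !product_mapE /= -hM hb.
Qed.

End Intertwining.

Section VirtualDiagonalTheory.
Variables (R : realType) (A : banachAlgType R) (M : dual (dual (ptensor A A))).
Hypothesis vM : virtual_diagonal M.

Lemma virtual_diagonal_comm a (f : dual (ptensor A A)) :
  M (adj (tensor_lact a) f) = M (adj (tensor_ract a) f).
Proof. by have := vM.1 a => /(congr1 (fun N : dual (dual _) => N f)). Qed.

Lemma virtual_diagonal_bmull a (g : dual A) :
  M (adj (product_map A) (adj (bmull a) g)) = g a.
Proof. by have := (vM.2 a).1 => /(congr1 (fun N : dual (dual _) => N g)). Qed.

Lemma virtual_diagonal_bmulr a (g : dual A) :
  M (adj (product_map A) (adj (bmulr a) g)) = g a.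
Proof. by have := (vM.2 a).2 => /(congr1 (fun N : dual (dual _) => N g)). Qed.

End VirtualDiagonalTheory.

Lemma virtual_diagonalP (R : realType) (A : banachAlgType R)
    (M : dual (dual (ptensor A A))) :
  (forall a f, M (adj (tensor_lact a) f) = M (adj (tensor_ract a) f)) ->
  (forall a g, M (adj (product_map A) (adj (bmull a) g)) = g a) ->
  (forall a g, M (adj (product_map A) (adj (bmulr a) g)) = g a) ->
  virtual_diagonal M.
Proof.
move=> Mc Ml Mr; split=> [a|a]; first by apply: bopP => f; exact: Mc.
by split; apply: bopP => g; [exact: Ml|exact: Mr].
Qed.

Section SurjectiveImage.
Variables (R : realType) (A B : banachAlgType R) (h : bop A B).
Hypothesis hM : {morph h : x y / bmul x y}.
Hypothesis h_surj : forall b, exists a, h a = b.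

(** Each [b] is some [h a], and the adjoint of [ptensor_map h h] carries the conditions for [b] back
    to those that [M] satisfies for [a]. *)
Lemma virtual_diagonal_image M :
  virtual_diagonal M -> virtual_diagonal (second_adj (ptensor_map h h) M).
Proof.
move=> vM; apply: virtual_diagonalP => b f; have [a <-] := h_surj b.
- rewrite !adjE (adj_tensor_lact (a := a)); last by move=> x; rewrite hM.
  rewrite (adj_tensor_ract (a := a)); last by move=> x; rewrite hM.
  exact: virtual_diagonal_comm.
- rewrite !adjE (adj_product_bmull hM (a := a)); last by move=> x; rewrite hM.
  by rewrite virtual_diagonal_bmull.
- rewrite !adjE (adj_product_bmulr hM (a := a)); last by move=> x; rewrite hM.
  by rewrite virtual_diagonal_bmulr.
Qed.

(** The second adjoint of [ptensor_map h h] has norm at most the square of [opnorm h], so pushing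
    forward does not increase norms. *)
Lemma AM_image : opnorm h <= 1 -> (AM B <= AM A)%E.
Proof.
move=> h1; apply: le_ereal_inf_tmp => _ [M vM <-].
apply: ge_ereal_inf; exists (rnorm (second_adj (ptensor_map h h) M))%:E.
  by exists (second_adj (ptensor_map h h) M) => //; exact: virtual_diagonal_image.
rewrite lee_fin (le_trans (opnorm_ub _ _))// ler_piMl ?rnorm_ge0//.
rewrite (le_trans (opnorm_adj _))// (le_trans (opnorm_adj _))//.
by rewrite (le_trans (opnorm_ptensor_map _ _))// mulr_ile1 ?opnorm_ge0.
Qed.

End SurjectiveImage.

(** * Coordinates and diagonal blocks of the c_0-sum *)

Definition fset_sum (I : choiceType) (V : zmodType) (c : I -> V) (S : {fset I}) : V :=
  \sum_(i <- S) c i.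

Section C0Coordinates.
Variables (R : realType) (I : choiceType) (A : I -> banachAlgType R).
Implicit Types i j : I.

Definition c0proj_fun i (a : c0sum A) : A i := a i.

Lemma c0proj_lin i : linear (c0proj_fun i). Proof. by []. Qed.

Lemma c0proj_le i a : rnorm (c0proj_fun i a) <= 1 * rnorm a.
Proof. by rewrite mul1r; exact: c0norm_ub. Qed.

Definition c0proj i : bop (c0sum A) (A i) :=
  Bop (@c0proj_lin i) (ex_intro _ _ (@c0proj_le i)).

Lemma opnorm_c0proj i : opnorm (c0proj i) <= 1.
Proof. by apply: opnorm_le => // a; exact: c0proj_le. Qed.

(** A dependent update of the zero family: [x] need not be transported along an equality of
    indices. *)
Definition c0inj_val i (x : A i) : forall j, A j := 
  dfwith (fun j => 0 : A j) i x.

Lemma c0inj_vanishes i (x : A i) : vanishes_at_infinity (c0inj_val x).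
Proof.
move=> e e0; apply: (@sub_finite_set _ _ [set i]); last exact: finite_set1.
move=> j /=; rewrite /c0inj_val; case: dfwithP => // k _.
by rewrite rnorm0 leNgt e0.
Qed.

Definition c0inj_fun i (x : A i) : c0sum A := C0sum (c0inj_vanishes x).

Lemma c0inj_eq i (x : A i) : c0inj_val x i = x.
Proof. exact: dfwithin. Qed.

Lemma c0inj_neq i j (x : A i) : i != j -> c0inj_val x j = 0.
Proof. exact: dfwithout. Qed.

Lemma c0inj_ext i (x : A i) (a : c0sum A) :
  a i = x -> (forall j, i != j -> a j = 0) -> a = c0inj_fun x.
Proof.
move=> ai aj; apply: c0sum_ext => j; have [<-|ij] := eqVneq i j.
  by rewrite /= c0inj_eq.
by rewrite /= c0inj_neq ?aj.
Qed.

Lemma c0inj_lin i : linear (@c0inj_fun i).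
Proof.
move=> c x y; apply/esym/c0inj_ext => [|j ij]; rewrite c0sumDE c0sumZE/=.
  by rewrite !c0inj_eq.
by rewrite !c0inj_neq// scaler0 addr0.
Qed.

Lemma c0inj_le i (x : A i) : rnorm (c0inj_fun x) <= 1 * rnorm x.
Proof.
rewrite mul1r; apply: c0norm_le => [|j]; first exact: rnorm_ge0.
have [<-|ij] := eqVneq i j; first by rewrite /= c0inj_eq.
by rewrite /= c0inj_neq// rnorm0 rnorm_ge0.
Qed.

Definition c0inj i : bop (A i) (c0sum A) :=
  Bop (@c0inj_lin i) (ex_intro _ _ (@c0inj_le i)).

Lemma c0injK i (x : A i) : c0proj i (c0inj i x) = x.
Proof. exact: c0inj_eq. Qed.

(** With its right-hand counterpart: the image of [A i] is a two-sided ideal on which [a] acts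
    through [a i] alone. This is the compatibility that the intertwining relations ask for. *)
Lemma c0inj_bmull i (a : c0sum A) (x : A i) :
  bmul a (c0inj i x) = c0inj i (bmul (a i) x).
Proof.
apply: c0inj_ext => [|j ij]; rewrite -[LHS]/(bmul (a _) (c0inj_val x _)).
  by rewrite c0inj_eq.
by rewrite c0inj_neq// (lin0 (bmull_lin _)).
Qed.

Lemma c0inj_bmulr i (a : c0sum A) (x : A i) :
  bmul (c0inj i x) a = c0inj i (bmul x (a i)).
Proof.
apply: c0inj_ext => [|j ij]; rewrite -[LHS]/(bmul (c0inj_val x _) (a _)).
  by rewrite c0inj_eq.
by rewrite c0inj_neq// (lin0 (bmulr_lin _)).
Qed.

Lemma c0inj_bmul i : {morph c0inj i : x y / bmul x y}.
Proof. by move=> x y; rewrite c0inj_bmull /= c0inj_eq. Qed.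

Lemma AM_c0proj i : (AM (A i) <= AM (c0sum A))%E.
Proof.
apply: (@AM_image _ _ _ (c0proj i)) => //; last exact: opnorm_c0proj.
by move=> x; exists (c0inj i x); exact: c0injK.
Qed.

(** Written as an adjoint, so that the intertwining relations apply to it directly. *)
Definition block_restriction (f : dual (ptensor (c0sum A) (c0sum A))) i :
  dual (ptensor (A i) (A i)) := adj (ptensor_map (c0inj i) (c0inj i)) f.

Lemma block_restrictionE f i x y :
  block_restriction f i (ptens x y) = f (ptens (c0inj i x) (c0inj i y)).
Proof. by rewrite /block_restriction adjE ptensor_mapE. Qed.

(* Parallelogram identity
   B(u, v) + B(x, y) = (B(u + x, v + y) + B(u - x, v - y)) / 2,
   applied one coordinate at a time: [u +- x] has norm at most 1 again, since
   u and x have disjoint supports. *)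
Lemma diagonal_Re_sum_le (f : dual (ptensor (c0sum A) (c0sum A)))
    (x y : forall i, A i) (s : seq I) (u v : c0sum A) :
  (forall i, rnorm (x i) <= 1) -> (forall i, rnorm (y i) <= 1) -> uniq s ->
  rnorm u <= 1 -> rnorm v <= 1 ->
  {in s, forall i, u i = 0} -> {in s, forall i, v i = 0} ->
  complex.Re (f (ptens u v)) +
    \sum_(i <- s) complex.Re (block_restriction f i (ptens (x i) (y i)))
  <= opnorm f.
Proof.
move=> x1 y1; elim: s u v => [|i s IH] u v.
  move=> _ u1 v1 _ _; rewrite big_nil addr0.
  apply: le_trans (ler_norm _) _; apply: le_trans (normr_Re_le _) _.
  apply: le_trans (opnorm_ub _ _) _; rewrite ler_piMr ?opnorm_ge0//.
  by rewrite (le_trans (rnorm_ptens_le _ _))// mulr_ile1 ?rnorm_ge0.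
rewrite cons_uniq => /andP[iNs us] u1 v1 u0 v0.
have [b1 b2] := ptens_bilinear (c0sum A) (c0sum A).
(* A unimodular [e] treats both signs together. *)
have add1 (e : R[i]) (w : c0sum A) (z : A i) : rnorm (e : R[i]^o) = 1 ->
    rnorm w <= 1 -> w i = 0 -> rnorm z <= 1 -> rnorm (w + e *: c0inj i z) <= 1.
  move=> e1 w1 w0 z1; apply: c0norm_le => // j; rewrite c0sumDE c0sumZE.
  have [<-|ij] := eqVneq i j.
    by rewrite w0 add0r /= c0inj_eq rnormZ e1 mul1r.
  by rewrite /= c0inj_neq// scaler0 addr0 (le_trans (c0norm_ub w j)).
have add0 (e : R[i]) (w : c0sum A) (z : A i) :
    {in i :: s, forall j, w j = 0} -> {in s, forall j, (w + e *: c0inj i z) j = 0}.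
  move=> w0 j js; rewrite c0sumDE c0sumZE w0 ?inE ?js ?orbT// /= c0inj_neq.
    by rewrite scaler0 addr0.
  by apply: contraNneq iNs => ->.
have step (e : R[i]) : rnorm (e : R[i]^o) = 1 ->
    complex.Re (f (ptens (u + e *: c0inj i (x i)) (v + e *: c0inj i (y i)))) +
    \sum_(j <- s) complex.Re (block_restriction f j (ptens (x j) (y j)))
    <= opnorm f.
  move=> e1; apply: IH => //.
  - by apply: add1 => //; apply: u0; rewrite mem_head.
  - by apply: add1 => //; apply: v0; rewrite mem_head.
  - exact: add0.
  - exact: add0.
(* On adding the two instances, the mixed terms in [u], [y i] and in [x i], [v] cancel; half of the
   sum is the claim. *)
have := step 1 (rnorm_real ler01); have := step (-1) (rnorm_N1 R).
rewrite big_cons !scaleN1r !scale1r block_restrictionE.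
rewrite !(linD (b1 _)) !(linD (b2 _)) !(linN (b1 _)) !(linN (b2 _)) opprK.
rewrite !(linD (bop_lin f)) !(linN (bop_lin f)) !raddfD !raddfN/=.
set S := \sum_(j <- s) _; lra.
Qed.

(** In each block, pick unit-ball vectors that almost attain the norm of the block, and apply the
    diagonal estimate to them. *)
Lemma sum_opnorm_block_restriction f (s : seq I) : uniq s ->
  \sum_(i <- s) opnorm (block_restriction f i) <= opnorm f.
Proof.
move=> us; apply/ler_addgt0Pr => e e0.
(* Each of the [size s] blocks may lose [e / (size s).+1], less than [e] in total; the successor
   avoids a zero divisor for empty [s]. *)
have n0 : 0 < (size s).+1%:R :> R by rewrite ltr0n.
have h i : {p : A i * A i | [/\ rnorm p.1 <= 1, rnorm p.2 <= 1 &
    opnorm (block_restriction f i) - e / (size s).+1%:R <=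
    complex.Re (block_restriction f i (ptens p.1 p.2))]}.
  apply: cid; have [x [y xy]] :=
    dual_ptensor_attains (block_restriction f i) (divr_gt0 e0 n0).
  by exists (x, y).
pose x i := (sval (h i)).1; pose y i := (sval (h i)).2.
(* Starting from [u = v = 0] leaves all coordinates free and makes the extra term vanish. *)
have := @diagonal_Re_sum_le f x y s 0 0.
have x1 i : rnorm (x i) <= 1 by rewrite /x; case: (svalP (h i)).
have y1 i : rnorm (y i) <= 1 by rewrite /y; case: (svalP (h i)).
rewrite !rnorm0 => /(_ x1 y1 us ler01 ler01 (fun _ _ => erefl) (fun _ _ => erefl)).
rewrite (lin0 ((ptens_bilinear _ _).1 _)) (lin0 (bop_lin f)) add0r => hs.
apply: (@le_trans _ _ (\sum_(i <- s) (complex.Re (block_restriction f i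
    (ptens (x i) (y i))) + e / (size s).+1%:R))).
  by apply: ler_sum => i _; rewrite -lerBlDr; case: (svalP (h i)).
rewrite big_split/= lerD// big_const_seq count_predT iter_addr_0.
by rewrite -(mulr_natr (e / _)) mulrAC ler_pdivrMr// ler_wpM2l ?ler_nat// ltW.
Qed.

(** Convergence along [totally] is convergence over finite index sets directed by inclusion.
    Membership in c_0 enters here: once [S] contains the finitely many [i] with [e <= rnorm (a i)],
    the remainder has norm at most [e]. *)
Lemma c0sum_cvg (a : c0sum A) :
  fset_sum (fun i => c0inj i (a i)) @ totally --> a.
Proof.
apply/cvgrPdist_le => e /complex_gt0[e0 <-].
have /finite_fsetP[F FE] := c0sumP a e0.
exists F => // S FS; rewrite normE lecR; apply: c0norm_le => [|j]; first exact: ltW.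
have sumE : fset_sum (fun i => c0inj i (a i)) S j = if j \in S then a j else 0.
  have -> : fset_sum (fun i => c0inj i (a i)) S j = \sum_(i <- S) c0inj i (a i) j.
    by rewrite /fset_sum; elim/big_ind2: _ => // ? ? ? ? <- <-.
  case: ifPn => [jS|jS].
    rewrite (big_fsetD1 j)//= c0inj_eq big1_fset ?addr0// => i.
    by rewrite !inE => /andP[ij _] _; rewrite /= c0inj_neq.
  rewrite big1_fset// => i iS _; rewrite /= c0inj_neq//.
  by apply: contraNneq jS => <-.
rewrite c0sumBE sumE; case: ifPn => [_|jS]; first by rewrite subrr rnorm0 ltW.
rewrite subr0 leNgt; apply/negP => /ltW ej.
have /(fsubsetP FS) : j \in F by have : [set` F] j by rewrite -FE.
by apply/negP.
Qed.

End C0Coordinates.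

(** * Continuity and unordered sums *)

Lemma bop_cvg (R : realType) (X Y : normedModType R[i]) (f : bop X Y)
    (T : Type) (F : set_system T) {FF : Filter F} (u : T -> X) (l : X) :
  u x @[x --> F] --> l -> f (u x) @[x --> F] --> f l.
Proof.
move=> /cvgrPdist_lt ul; apply/cvgrPdist_lt => e /complex_gt0[e0 <-].
have k0 : 0 < opnorm f + 1 by rewrite ltr_wpDl ?opnorm_ge0.
have /ul : 0 < (complex.Re e / (opnorm f + 1))%:C by rewrite ltcR divr_gt0.
apply: filterS => x; rewrite !normE !ltcR ltr_pdivlMr// => h.
rewrite -(linB (bop_lin f)) (le_lt_trans (opnorm_ub _ _))//.
by rewrite (le_lt_trans _ h)// mulrC ler_wpM2l ?rnorm_ge0// lerDl.
Qed.

Section UnorderedSum.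
Variables (R : realType) (I : choiceType) (c : I -> cplx R) (r : I -> R) (k : R).
Hypothesis cr : forall i, rnorm (c i) <= r i.
Hypothesis rk : forall S : {fset I}, \sum_(i <- S) r i <= k.

(** Absolute summability over an index set of any cardinality: if the sum of [r] over [S] is within
    [e] of the supremum [sup P], then any finite set disjoint from [S] contributes less than [e]. *)
Lemma unordered_sum_cvg : cvg (fset_sum c @ totally).
Proof.
pose P := [set \sum_(i <- S) r i | S in [set: {fset I}]].
have supP : has_sup P.
  by split; [exists (\sum_(i <- fset0) r i), fset0|exists k => _ [S _ <-]].
apply: cauchy_cvg; apply: cauchy_exP => e /complex_gt0[e0 <-].
have [_ [S _ <-] ltS] := sup_adherent e0 supP.
exists (fset_sum c S); exists S => // T ST.
rewrite /fset_sum/= -ball_normE/= normE ltcR.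
(* Stated for any group, as it splits the sums of [c] and of [r] alike. *)
have split_sum (V : zmodType) (h : I -> V) :
    \sum_(i <- T) h i = \sum_(i <- S) h i + \sum_(i <- (T `\` S)%fset) h i.
  rewrite (big_fsetID _ (mem S))/=; congr (_ + _); apply: eq_fbigl => i.
    by rewrite !inE andbC; case: (boolP (i \in S)) => //= /(fsubsetP ST) ->.
  by rewrite !inE andbC.
rewrite split_sum opprD addNKr rnormN (le_lt_trans (ler_rnorm_sum _ _))//.
rewrite (@le_lt_trans _ _ (\sum_(i <- (T `\` S)%fset) r i)) ?ler_sum//.
have : \sum_(i <- T) r i <= sup P.
  by apply: sup_ubound; [exact: supP.2|exists T].
by rewrite split_sum; move: ltS; lra.
Qed.

Lemma unordered_sum_le (l : cplx R) :
  fset_sum c @ totally --> l -> rnorm l <= k.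
Proof.
move=> /cvgrPdist_lt cl; apply/ler_addgt0Pl => e e0.
have /cl[S _ /(_ S (fsubset_refl S))] : 0 < e%:C by rewrite ltcR.
rewrite /= normE ltcR => lS.
rewrite -[l](subrK (fset_sum c S)) (le_trans (ler_rnormD _ _))//.
rewrite lerD ?(ltW lS)// (le_trans (ler_rnorm_sum _ _))//.
by rewrite (le_trans _ (rk S))// ler_sum.
Qed.

End UnorderedSum.

(** * Gluing virtual diagonals of the summands *)

Section C0Amenable.
Variables (R : realType) (I : choiceType) (A : I -> banachAlgType R).
Variables (M : forall i, dual (dual (ptensor (A i) (A i)))) (k : R).
Hypothesis vM : forall i, virtual_diagonal (M i).
Hypothesis k0 : 0 <= k.
Hypothesis Mk : forall i, rnorm (M i) <= k.
Local Notation AA := (ptensor (c0sum A) (c0sum A)).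
Implicit Types f : dual AA.

Definition c0diag_term f i : cplx R := M i (block_restriction f i).

(** The limit lives in the complete copy [cplx R]; the result is typed in [R[i]^o], where the
    functionals of [dual] take their values. *)
Definition c0diag_fun (f : dual AA) : R[i]^o :=
  lim (fset_sum (c0diag_term f) @ totally).

Lemma c0diag_le_term f i :
  rnorm (c0diag_term f i) <= k * opnorm (block_restriction f i).
Proof.
by rewrite (le_trans (opnorm_ub _ _))// ler_wpM2r ?opnorm_ge0 ?Mk.
Qed.

Lemma c0diag_le_sum f (S : {fset I}) :
  \sum_(i <- S) k * opnorm (block_restriction f i) <= k * opnorm f.
Proof. by rewrite -mulr_sumr ler_wpM2l// sum_opnorm_block_restriction. Qed.

Lemma c0diag_cvg f :
  fset_sum (c0diag_term f) @ totally --> (c0diag_fun f : cplx R).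
Proof. exact: unordered_sum_cvg (c0diag_le_term f) (@c0diag_le_sum f). Qed.

Lemma c0diag_funE f (l : R[i]) :
  fset_sum (c0diag_term f) @ totally --> (l : cplx R) -> c0diag_fun f = l.
Proof. exact: (cvg_lim (@norm_hausdorff _ (cplx R))). Qed.

Lemma c0diag_lin : linear c0diag_fun.
Proof.
move=> a f g; apply: c0diag_funE.
rewrite (_ : fset_sum _ = fun S =>
    a *: fset_sum (c0diag_term f) S + fset_sum (c0diag_term g) S).
  by apply: cvgD; [apply: cvgZr|]; exact: c0diag_cvg.
apply/funext => S; rewrite /fset_sum scaler_sumr -big_split; apply: eq_bigr => i _ /=.
by rewrite /c0diag_term /block_restriction (bop_lin (adj _)) (bop_lin (M i)).
Qed.

Lemma c0diag_le f : rnorm (c0diag_fun f) <= k * rnorm f.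
Proof.
exact: (unordered_sum_le (c0diag_le_term f) (@c0diag_le_sum f) (@c0diag_cvg f)).
Qed.

Definition c0diag : dual (dual AA) := Bop c0diag_lin (ex_intro _ k c0diag_le).

(** The continuous functional [g] is applied to the expansion of [a] into its coordinates. Both
    identity conditions on the product map reduce to this. *)
Lemma c0diag_evalE f (g : dual (c0sum A)) (a : c0sum A) :
  (forall i, c0diag_term f i = g (c0inj A i (a i))) -> c0diag f = g a.
Proof.
move=> fg; apply: c0diag_funE.
rewrite (_ : fset_sum _ = fun S => g (fset_sum (fun i => c0inj A i (a i)) S)).
  exact: (bop_cvg (f := g) (@c0sum_cvg _ _ _ a)).
apply/funext => S; rewrite /fset_sum; elim: (enum_fset S) => [|i s IH].
  by rewrite !big_nil (lin0 (bop_lin g)).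
by rewrite !big_cons (linD (bop_lin g)) IH fg.
Qed.

Lemma c0diag_virtual_diagonal : virtual_diagonal c0diag.
Proof.
apply: virtual_diagonalP => a f.
(* The two families of terms coincide index by index, since each [M i] commutes with [a i]; hence so
   do the limits. *)
- suff tE : c0diag_term (adj (tensor_lact a) f) = c0diag_term (adj (tensor_ract a) f).
    exact: (congr1 (fun c => lim (fset_sum c @ totally)) tE).
  apply/funext => i; rewrite /c0diag_term /block_restriction.
  rewrite (adj_tensor_lact (a := a i)); last by move=> x; rewrite c0inj_bmull.
  rewrite (adj_tensor_ract (a := a i)); last by move=> x; rewrite c0inj_bmulr.
  exact: virtual_diagonal_comm.
- apply: c0diag_evalE => i; rewrite /c0diag_term /block_restriction.
  rewrite (adj_product_bmull (@c0inj_bmul _ _ _ i) (a := a i)).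
    by rewrite virtual_diagonal_bmull.
  by move=> x; rewrite c0inj_bmull.
- apply: c0diag_evalE => i; rewrite /c0diag_term /block_restriction.
  rewrite (adj_product_bmulr (@c0inj_bmul _ _ _ i) (a := a i)).
    by rewrite virtual_diagonal_bmulr.
  by move=> x; rewrite c0inj_bmulr.
Qed.

Lemma AM_c0sum_le : (AM (c0sum A) <= k%:E)%E.
Proof.
apply: ge_ereal_inf; exists (rnorm c0diag)%:E.
  by exists c0diag => //; exact: c0diag_virtual_diagonal.
by rewrite lee_fin; apply: opnorm_le => // f; exact: c0diag_le.
Qed.

End C0Amenable.

(** * The amenability constant of the c_0-sum *)

Lemma AM_ge0 (R : realType) (A : banachAlgType R) : (0 <= AM A)%E.
Proof. by apply: le_ereal_inf_tmp => _ [M _ <-]; rewrite lee_fin rnorm_ge0. Qed.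

Lemma AM_lty (R : realType) (A : banachAlgType R) : (AM A < +oo)%E <-> amenable A.
Proof.
split=> [|[M vM]]; first by apply: contraPP => /AM_not_amenable ->; rewrite ltxx.
by apply: (@le_lt_trans _ _ (rnorm M)%:E); [apply: ereal_inf_lbound; exists M|exact: ltry].
Qed.

Lemma AM_lt_ex (R : realType) (A : banachAlgType R) (k : \bar R) : (AM A < k)%E ->
  exists M : dual (dual (ptensor A A)), virtual_diagonal M /\ ((rnorm M)%:E < k)%E.
Proof. by move=> /ereal_inf_lt[_ [M vM <-] Mk]; exists M. Qed.

Lemma AM_c0sum (R : realType) (I : choiceType) (A : I -> banachAlgType R) :
  inhabited I -> AM (c0sum A) = ereal_sup [set AM (A i) | i in [set: I]].
Proof.
move=> [i0]; apply/eqP; rewrite eq_le; apply/andP; split; last first.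
  by apply: ge_ereal_sup => _ [i _ <-]; exact: AM_c0proj.
set s := ereal_sup _.
have sub i : (AM (A i) <= s)%E by apply: ereal_sup_ubound; exists i.
(* An index is needed: the supremum of an empty family would be [-oo]. *)
have s0 : (0 <= s)%E := le_trans (AM_ge0 _) (sub i0).
move: s s0 sub => [s| |]// s0 sub; last by rewrite leey.
apply/lee_addgt0Pr => e e0; rewrite -EFinD.
(* Since [s] is finite, every summand has a virtual diagonal of norm below the common bound [s + e];
   [cid] selects one for each index. *)
have h i : {M : dual (dual (ptensor (A i) (A i))) |
    virtual_diagonal M /\ ((rnorm M)%:E < (s + e)%:E)%E}.
  by apply/cid/AM_lt_ex/(le_lt_trans (sub i)); rewrite lte_fin ltrDl.
apply: (@AM_c0sum_le _ _ _ (fun i => sval (h i))).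
- by move=> i; case: (svalP (h i)).
- by rewrite addr_ge0 ?(ltW e0).
- by move=> i; case: (svalP (h i)) => _; rewrite lte_fin => /ltW.
Qed.

Theorem corollary5p1 (R : realType) (I : Type) (A : I -> banachAlgType R)
    (I_inhabited : inhabited I) :
  AM (c0sum A) = ereal_sup [set AM (A i) | i in [set: I]]%classic /\
  (amenable (c0sum A) <->
   (ereal_sup [set AM (A i) | i in [set: I]]%classic < +oo)%E).
Proof.
have E : AM (c0sum A) = ereal_sup [set AM (A i) | i in [set: I]]%classic.
  (* [{classic I}] gives an arbitrary index type the choice structure that finite sets of indices
     require. *)
  exact: (@AM_c0sum R {classic I} A I_inhabited).
by split=> //; rewrite -E; apply: iff_sym; exact: AM_lty.
Qed.
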